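(* Let $G=(V,E,w)$ be a connected edge-weighted graph with minimum pairwise distance $1$, and let $\alpha,\beta,\tau\ge 0$. Suppose that for every $\Delta>0$ there is a dangling net $N=N_\Delta$ for $G$ such that: (i) $N$ is $\Delta$-covering and $(\alpha,\tau)$-sparse; and (ii) every instance of cluster aggregation on the graph $G+N$ with portal set $N$ (for every partition of $V\sqcup N$ and every bound on the strong diameter of its clusters) has a $\beta$-distortion solution. Then $G$ has a $\gamma$-hierarchy of strong $(8\alpha+4,\tau)$-sparse partitions with $\gamma=2\beta(2\alpha+1)$. Furthermore, if each such $N$ and each such cluster aggregation solution is computable in polynomial time, then the hierarchy is computable in polynomial time.
   Context: Graphs are finite and undirected with positive edge weights; $d_G$ is the shortest-path distance, $d_G(v,S)=\min_{u\in S}d_G(v,u)$, $B_G(v,r)=\{u: d_G(u,v)\le r\}$, and $G[C]$ is the induced subgraph. A set $C$ has strong diameter at most $\Delta$ if $G[C]$ has diameter at most $\Delta$ (distances in $G[C]$). It is assumed (by scaling) that the minimum distance between distinct vertices of $G$ is $1$. Sparse partitions: a strong $\Delta$-diameter $(\alpha,\tau)$-sparse partition of $G$ is a partition $\mathcal C$ of $V$ such that every $C\in\mathcal C$ has strong diameter at most $\Delta$, and for every $v\in V$ the ball $B_G(v,\Delta/\alpha)$ intersects at most $\tau$ clusters of $\mathcal C$. Hierarchy: a $\gamma$-hierarchy of strong $(\alpha,\tau)$-sparse partitions consists of partitions $\{\{v\}:v\in V\}=\mathcal C_0,\mathcal C_1,\dots,\mathcal C_k=\{V\}$ such that $\mathcal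 C_i$ is a strong $\gamma^i$-diameter $(\alpha,\tau)$-sparse partition for every $i$, and $\mathcal C_{i+1}$ coarsens $\mathcal C_i$ (each $U\in\mathcal C_i$ is contained in some $U'\in\mathcal C_{i+1}$). Dangling net: a dangling net for $G$ consists of a set $N$ of new vertices ($N\cap V=\emptyset$) and a matching $M$ from $N$ to $V$ (each $t\in N$ is joined by one edge to a vertex of $V$, distinct $t$ to distinct vertices) with nonnegative edge weights $w_M$; $G+N:=(V\sqcup N,E\sqcup M,w\sqcup w_M)$. It is $\Delta$-covering if $d_{G+N}(v,N)\le\Delta$ for all $v\in V$, and $(\alpha,\tau)$-sparse (with respect to $\Delta$) if $|\{t\in N: d_{G+N}(v,t)\le d_{G+N}(v,N)+\Delta/\alpha\}|\le\tau$ for all $v\in V$; for $\alpha=0$ read $\Delta/\alpha=+\infty$. Cluster aggregation: an instance on a graph $H$ with vertex set $W$ consists of a partition $\mathcal C$ of $W$ into clusters of strong diameter at most $\Delta'$, where $\Delta'>0$ is part of the instance, and a set of portals $P\subseteq W$. A $\beta$-distortion solution is an assignment $f:\mathcal C\to P$ such that, writing $f(v):=f(C_v)$ for the cluster $C_v\ni v$ and $f^{-1}(p):=\{v\in W: f(v)=p\}$, one has for every $v\in W$ $$d_{H[f^{-1}(f(v))]}(v,f(v))\le d_H(v,P)+\beta\cdot\Delta'.$$ *)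

(* Defs.v *)
(* [finset] last: its [partition] shadows the one of [classical_sets]. *)
From mathcomp Require Import all_boot all_order all_algebra.
From mathcomp Require Import boolp classical_sets constructive_ereal reals ereal.
From mathcomp Require Import finset.

Set Implicit Arguments.
Unset Strict Implicit.
Unset Printing Implicit Defensive.

Import Order.TTheory GRing.Theory Num.Theory.
Local Open Scope ring_scope.
Local Obligation Tactic := idtac.

(** * Weighted graphs *)

(* Weights are only required to be nonnegative here, because the edges that
   join a dangling net to the graph may have weight 0; see [positive_weights].
   The value of [wt] outside of the edges is irrelevant. *)
Record wgraph (R : numDomainType) (T : finType) := WGraph {
  edge : rel T;
  wt : T -> T -> R;
  edge_sym : symmetric edge;
  edge_irr : irreflexive edge;
  wt_sym : forall u v, wt u v = wt v u;
  wt_ge0 : forall u v, edge u v -> 0 <= wt u v }.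

Definition positive_weights (R : numDomainType) (T : finType)
    (G : wgraph R T) : Prop :=
  forall u v, edge G u v -> 0 < wt G u v.

(* [G[C]], kept on the vertex type of [G]: the vertices outside of [C] become
   isolated. *)
Program Definition induced (R : numDomainType) (T : finType)
    (G : wgraph R T) (C : {set T}) : wgraph R T :=
  @WGraph R T (fun u v => [&& edge G u v, u \in C & v \in C]) (wt G) _ _ _ _.
Next Obligation.
by move=> R T G C u v /=; rewrite edge_sym [(v \in C) && _]andbC.
Qed.
Next Obligation. by move=> R T G C u /=; rewrite edge_irr. Qed.
Next Obligation. by move=> R T G C; apply: wt_sym. Qed.
Next Obligation. by move=> R T G C u v /= /and3P[/wt_ge0]. Qed.

Section Distance.
Variables (R : realType) (T : finType).
Implicit Types (G : wgraph R T) (C S : {set T}) (CC : {set {set T}}).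

Fixpoint walk_length G (u : T) (p : seq T) : R :=
  if p is v :: q then wt G u v + walk_length G v q else 0.

(* [+oo] if there is no walk from [u] to [v]. *)
Definition dist G (u v : T) : \bar R :=
  ereal_inf [set (walk_length G u p)%:E | p in
              [set p : seq T | path (edge G) u p /\ last u p = v]]%classic.

Definition dist_set G (v : T) S : \bar R :=
  \big[Order.min/+oo%E]_(u in S) dist G v u.

Definition ball G (v : T) (r : \bar R) : {set T} :=
  [set u | (dist G u v <= r)%E].

Definition connected G : Prop := forall u v, connect (edge G) u v.

(* For a one-vertex graph there is no pair of distinct vertices, and the
   condition is void. *)
Definition min_distance_one G : Prop :=
  (forall u v, u != v -> (1%:E <= dist G u v)%E) /\
  ((exists u v : T, u != v) ->
    exists u v : T, u != v /\ dist G u v = 1%:E).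

Definition strong_diam_le G (D : R) C : Prop :=
  forall u v, u \in C -> v \in C -> (dist (induced G C) u v <= D%:E)%E.

(** * Sparse partitions and hierarchies *)

(* [D / alpha], with the convention [D / 0 = +oo]. *)
Definition radius (D alpha : R) : \bar R :=
  if alpha == 0 then +oo%E else (D / alpha)%:E.

Definition sparse_partition G (D alpha tau : R) CC : Prop :=
  [/\ partition CC [set: T],
      forall C, C \in CC -> strong_diam_le G D C &
      forall v, #|[set C in CC | C :&: ball G v (radius D alpha) != set0]|%:R
                <= tau].

Definition hierarchy G (gamma alpha tau : R) (k : nat)
    (CC : nat -> {set {set T}}) : Prop :=
  [/\ CC 0%N = [set [set v] | v : T],
      CC k = [set [set: T]],
      forall i, (i <= k)%N -> sparse_partition G (gamma ^+ i) alpha tau (CC i) &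
      forall i, (i < k)%N ->
        forall U, U \in CC i -> exists2 U', U' \in CC i.+1 & U \subset U'].

(** * Cluster aggregation *)

Definition aggregation_instance G (D' : R) CC : Prop :=
  [/\ 0 < D', partition CC [set: T] &
      forall C, C \in CC -> strong_diam_le G D' C].

(* Only the values of [f] on the clusters matter. If [f(v)] differs from [v]
   and does not belong to [f^-1(f(v))], then it is isolated in the induced
   graph and the left-hand side is [+oo]. *)
Definition aggregation_solution G (beta D' : R) CC (P : {set T})
    (f : {set T} -> T) : Prop :=
  (forall C, C \in CC -> f C \in P) /\
  forall v,
    let p := f (pblock CC v) in
    (dist (induced G [set u | f (pblock CC u) == p]) v p
       <= dist_set G v P + (beta * D')%:E)%E.

End Distance.

(** * Dangling nets *)

Record dangling_net (R : numDomainType) (T : finType) := DanglingNet {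
  net_vertex : finType;
  anchor : net_vertex -> T;
  anchor_wt : net_vertex -> R;
  anchor_inj : injective anchor;
  anchor_wt_ge0 : forall t, 0 <= anchor_wt t }.

Definition plus_edge (R : numDomainType) (T : finType)
    (G : wgraph R T) (N : dangling_net R T) : rel (T + net_vertex N) :=
  fun x y => match x, y with
    | inl u, inl v => edge G u v
    | inl u, inr t | inr t, inl u => anchor t == u
    | inr _, inr _ => false
    end.

Definition plus_wt (R : numDomainType) (T : finType)
    (G : wgraph R T) (N : dangling_net R T) (x y : T + net_vertex N) : R :=
  match x, y with
  | inl u, inl v => wt G u v
  | inl _, inr t | inr t, inl _ => anchor_wt t
  | inr _, inr _ => 0
  end.

(* The graph [G + N]. *)
Program Definition plus_net (R : numDomainType) (T : finType)
    (G : wgraph R T) (N : dangling_net R T) : wgraph R (T + net_vertex N)%type :=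
  @WGraph R (T + net_vertex N)%type (@plus_edge R T G N) (@plus_wt R T G N)
    _ _ _ _.
Next Obligation. by move=> R T G N [u|t] [v|s] //=; rewrite edge_sym. Qed.
Next Obligation. by move=> R T G N [u|t] //=; rewrite edge_irr. Qed.
Next Obligation. by move=> R T G N [u|t] [v|s] //=; rewrite wt_sym. Qed.
Next Obligation.
by move=> R T G N [u|t] [v|s] //=; [move/wt_ge0 | rewrite anchor_wt_ge0..].
Qed.

Definition portals (R : numDomainType) (T : finType) (N : dangling_net R T) :
    {set T + net_vertex N} :=
  [set inr t | t : net_vertex N].

Section Nets.
Variables (R : realType) (T : finType).
Implicit Types (G : wgraph R T) (N : dangling_net R T).

Definition net_covering G N (D : R) : Prop :=
  forall v : T, (dist_set (plus_net G N) (inl v) (portals N) <= D%:E)%E.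

Definition net_sparse G N (D alpha tau : R) : Prop :=
  forall v : T,
    #|[set t : net_vertex N |
        (dist (plus_net G N) (inl v) (inr t)
          <= dist_set (plus_net G N) (inl v) (portals N) + radius D alpha)%E]|%:R
    <= tau.

Definition net_aggregable G N (beta : R) : Prop :=
  forall (D' : R) (CC : {set {set T + net_vertex N}}),
    aggregation_instance (plus_net G N) D' CC ->
    exists f, aggregation_solution (plus_net G N) beta D' CC (portals N) f.

Definition good_net G (alpha beta tau D : R) N : Prop :=
  [/\ net_covering G N D, net_sparse G N D alpha tau & net_aggregable G N beta].

End Nets.

(** * Rational graphs and nets seen over the reals *)

Program Definition real_graph (R : realType) (T : finType) (G : wgraph rat T) :
    wgraph R T :=
  @WGraph R T (edge G) (fun u v => ratr (wt G u v)) _ _ _ _.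
Next Obligation. by move=> R T G; apply: edge_sym. Qed.
Next Obligation. by move=> R T G; apply: edge_irr. Qed.
Next Obligation. by move=> R T G u v /=; rewrite wt_sym. Qed.
Next Obligation. by move=> R T G u v /= /wt_ge0; rewrite ler0q. Qed.

Program Definition real_net (R : realType) (T : finType)
    (N : dangling_net rat T) : dangling_net R T :=
  @DanglingNet R T (net_vertex N) (@anchor _ _ N)
    (fun t => ratr (anchor_wt t)) _ _.
Next Obligation. by move=> R T N; apply: anchor_inj. Qed.
Next Obligation. by move=> R T N t /=; rewrite ler0q anchor_wt_ge0. Qed.

(** * Polynomial-time computation *)

(* The machine model is Jones' WHILE language in point-free form: structured
   programs over binary trees, whose leaves carry rational numbers. Each
   elementary operation is computable by a Turing machine in time polynomial
   in the bit-size of its argument, and it costs the bit-size of its argument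
   and of its result. In particular the size of an output never exceeds the
   running time, so that this model and Turing machines simulate each other
   with polynomial overhead. *)

Inductive data := Num of rat | Cell of data & data.

Definition bits (q : rat) : nat :=
  (trunc_log 2 `|numq q| + trunc_log 2 `|denq q|).+1.

Fixpoint dsize (d : data) : nat :=
  match d with
  | Num q => (bits q).+1
  | Cell a b => (dsize a + dsize b).+1
  end.

Inductive op :=
  | Id | Fst | Snd | Const of data | IsCell
  | Add | Sub | Mul | Div | Leq | Numer | Denom.

Definition dbool (b : bool) : data := Num (b%:R).

Definition truth (d : data) : bool := if d is Num q then q != 0 else true.

(* An operation applied to an argument of the wrong shape returns [Num 0]. *)
Definition op_eval (o : op) (x : data) : data :=
  match o, x with
  | Id, _ => x
  | Fst, Cell a _ => a
  | Snd, Cell _ b => b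
  | Const d, _ => d
  | IsCell, Cell _ _ => dbool true
  | Add, Cell (Num p) (Num q) => Num (p + q)
  | Sub, Cell (Num p) (Num q) => Num (p - q)
  | Mul, Cell (Num p) (Num q) => Num (p * q)
  | Div, Cell (Num p) (Num q) => Num (p / q)
  | Leq, Cell (Num p) (Num q) => dbool (p <= q)
  | Numer, Num q => Num (numq q)%:~R
  | Denom, Num q => Num (denq q)%:~R
  | _, _ => Num 0
  end.

Inductive prog :=
  | Op of op
  | Both of prog & prog
  | Seq of prog & prog
  | If of prog & prog & prog
  | While of prog & prog.

(* [runs p x y t]: on input [x], [p] halts with output [y] at cost [t]. *)
Inductive runs : prog -> data -> data -> nat -> Prop :=
  | RunOp o x :
      runs (Op o) x (op_eval o x) (dsize x + dsize (op_eval o x)).+1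
  | RunBoth p q x y z t s :
      runs p x y t -> runs q x z s -> runs (Both p q) x (Cell y z) (t + s).+1
  | RunSeq p q x y z t s :
      runs p x y t -> runs q y z s -> runs (Seq p q) x z (t + s).+1
  | RunIf c p q x b y t s :
      runs c x b t -> runs (if truth b then p else q) x y s ->
      runs (If c p q) x y (t + s).+1
  | RunWhileStop c p x b t :
      runs c x b t -> ~~ truth b -> runs (While c p) x x (t + dsize x).+1
  | RunWhileStep c p x b y z t s r :
      runs c x b t -> truth b -> runs p x y s -> runs (While c p) y z r ->
      runs (While c p) x z (t + s + r).+1.

(* The search problem that asks, for an instance [x] such that [dom x], given
   as [enc x], for some output [y] such that [spec x y]. *)
Definition poly_time_solvable (X : Type) (dom : X -> Prop) (enc : X -> data)
    (spec : X -> data -> Prop) : Prop :=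
  exists (p : prog) (c : nat), forall x, dom x ->
    exists (y : data) (t : nat),
      [/\ runs p (enc x) y t, (t <= c * dsize (enc x) ^ c)%N & spec x y].

(** * Encodings *)

(* A vertex of a finite graph is encoded by its rank in the enumeration of the
   vertex type. In [T + net_vertex N], the vertices of [T] come first. *)

Definition enc_nat (m : nat) : data := Num m%:R.

Definition enc_seq (s : seq data) : data := foldr Cell (Num 0) s.

Definition enc_fun (T : finType) (F : T -> data) : data :=
  enc_seq [seq F x | x <- enum T].

Definition enc_vertex (T : finType) (v : T) : data := enc_nat (enum_rank v).

(* The weighted adjacency matrix; an entry 0 stands for a non-edge, so that
   this encoding is meant for graphs with positive weights. *)
Definition enc_graph (T : finType) (G : wgraph rat T) : data :=
  enc_fun (fun u => enc_fun (fun v => Num (if edge G u v then wt G u v else 0))).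

Definition enc_net (T : finType) (N : dangling_net rat T) : data :=
  enc_fun (fun t : net_vertex N =>
    Cell (enc_vertex (anchor t)) (Num (anchor_wt t))).

(* A partition is given by a labelling of the vertices: two vertices belong to
   the same cluster when they have the same label. *)
Definition partition_of (T : finType) (lab : T -> nat) : {set {set T}} :=
  preim_partition lab [set: T].

Definition enc_labels (T : finType) (lab : T -> nat) : data :=
  enc_fun (fun v => enc_nat (lab v)).

Record instance := Instance {
  inst_vertex : finType;
  inst_graph : wgraph rat inst_vertex;
  inst_alpha : rat;
  inst_beta : rat;
  inst_tau : rat }.

Definition enc_instance (I : instance) : data :=
  Cell (enc_graph (inst_graph I))
    (Cell (Num (inst_alpha I)) (Cell (Num (inst_beta I)) (Num (inst_tau I)))).

Definition net_family := forall I : instance, rat -> dangling_net rat (inst_vertex I).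

(* The net [nets I D] is computable in polynomial time from [I] and [D]. *)
Definition nets_poly_time (K : instance -> Prop) (nets : net_family) : Prop :=
  @poly_time_solvable (instance * rat)
    (fun x => K x.1 /\ 0 < x.2)
    (fun x => Cell (enc_instance x.1) (Num x.2))
    (fun x y => y = enc_net (nets x.1 x.2)).

Record agg_input (nets : net_family) := AggInput {
  agg_inst : instance;
  agg_scale : rat;
  agg_label : inst_vertex agg_inst + net_vertex (nets agg_inst agg_scale) -> nat;
  agg_diam : rat }.

(* Given [I], [D], the net [N = nets I D], a partition of the vertices of
   [G + N], and a bound on the strong diameter of its clusters, a
   [beta]-distortion solution [f] is computable in polynomial time; the output
   lists [f(v)] for all vertices [v] of [G + N]. *)
Definition aggregation_poly_time (R : realType) (K : instance -> Prop)
    (nets : net_family) : Prop :=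
  @poly_time_solvable (agg_input nets)
    (fun x =>
      [/\ K (agg_inst x), 0 < agg_scale x &
          aggregation_instance
            (plus_net (real_graph R (inst_graph (agg_inst x)))
                      (real_net R (nets (agg_inst x) (agg_scale x))))
            (ratr (agg_diam x)) (partition_of (@agg_label _ x))])
    (fun x =>
      Cell (enc_instance (agg_inst x))
        (Cell (Num (agg_scale x))
          (Cell (enc_net (nets (agg_inst x) (agg_scale x)))
            (Cell (enc_labels (@agg_label _ x)) (Num (agg_diam x))))))
    (fun x y => exists2 f,
      aggregation_solution
        (plus_net (real_graph R (inst_graph (agg_inst x)))
                  (real_net R (nets (agg_inst x) (agg_scale x))))
        (ratr (inst_beta (agg_inst x))) (ratr (agg_diam x))
        (partition_of (@agg_label _ x))
        (portals (real_net R (nets (agg_inst x) (agg_scale x)))) f &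
      y = enc_fun (fun v => enc_vertex (f (pblock (partition_of (@agg_label _ x)) v)))).

(* The output lists the partitions [C_0, ..., C_k]. *)
Definition hierarchy_poly_time (R : realType) (K : instance -> Prop)
    (gamma alpha tau : instance -> R) : Prop :=
  @poly_time_solvable instance K enc_instance
    (fun I y => exists (k : nat) (lab : nat -> inst_vertex I -> nat),
      hierarchy (real_graph R (inst_graph I)) (gamma I) (alpha I) (tau I) k
        (fun i => partition_of (lab i)) /\
      y = enc_seq [seq enc_labels (lab i) | i <- iota 0 k.+1]).

(** * Standing assumptions *)

Definition admissible (R : realType) (T : finType) (G : wgraph R T)
    (alpha beta tau : R) : Prop :=
  [/\ [/\ (0 < #|T|)%N, positive_weights G, connected G & min_distance_one G],
      0 <= alpha, 0 <= beta & 0 <= tau].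

(* Main.v *)
From mathcomp Require Import all_boot all_order all_algebra.
From mathcomp Require Import boolp classical_sets constructive_ereal reals ereal.
From mathcomp Require Import finset zify ring lra.
(* Last, because [Num] is also a constructor of [ssrnat]. *)
Require Import Defs.

(** Level [i+1] is obtained by aggregating the clusters of level [i], which have
strong diameter at most [D' = gamma^i], towards a net [N] of covering radius
[2 alpha beta D'], the vertices of [N] being singleton clusters. The cluster of a
portal [t] is reached from the anchor of [t] within [(2 alpha + 1) beta D'], so its
diameter is at most [gamma^(i+1)]. If a ball of radius [beta D' / 2] around [v]
meets the cluster of [t], then [t] is within [2 beta D' = 2 alpha beta D' / alpha]
of being a closest portal of [v], so sparsity of the net bounds the number of such
clusters. One stops at the first [k] such that [gamma^k] exceeds the total weight [W]
of the graph, and replaces the last partition by [{V}].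

Two degenerate cases need an argument. For two vertices at distance 1 that form a
cluster, one of them is sent away from itself; for nets of small covering radius
this shows [beta >= 1], so [gamma >= 2] and [k = O(log W)]. For [alpha = 0] a net
of covering radius less than 1 has a portal at each vertex, so [#|V| <= tau] and
the singletons can be kept until the last level.

Clusters are represented by labels below [2 #|V|]: the label of [v] is the rank of
its portal, and there are at most [#|V|] portals. Hence all numbers in the loop
remain of polynomial size, and the loop runs in polynomial time although each
subprogram may increase the size of its input polynomially. *)

Set Implicit Arguments.
Unset Strict Implicit.
Unset Printing Implicit Defensive.

Import Order.TTheory GRing.Theory Num.Theory.
Local Open Scope ring_scope.

(** * Sizes of rational numbers *)

(** Unlike the bit-size, this measure is submultiplicative under both addition and multiplication,
    so bounds on long sums and powers follow by induction. Up to constants, [bits] is its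
    logarithm. *)
Definition height (q : rat) : nat := (`|numq q| + `|denq q|)%N.

(** Cross-multiplication and coprimality show that the reduced numerator divides [n] and the reduced
    denominator divides [d]. *)
Lemma height_frac (n d : int) : d != 0 -> (height (n%:~R / d%:~R) <= `|n| + `|d|)%N.
Proof.
move=> d0; set q := n%:~R / d%:~R.
have e : (`|numq q| * `|d| = `|n| * `|denq q|)%N.
  rewrite -!abszM; congr absz; apply: (@intr_inj rat); rewrite !intrM.
  have dr0 : (d%:~R : rat) != 0 by rewrite intr_eq0.
  by rewrite numqE /q [in LHS]mulrAC divfK.
have [cop d_gt0] : coprime `|numq q| `|denq q| /\ (0 < `|d|)%N.
  by rewrite coprime_num_den absz_gt0.
apply: leq_add.
  (* Divisibility bounds the numerator only if [n] is nonzero; for [n = 0] the numerator is 0. *)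
  have [n0|n_gt0] := posnP `|n|.
    by move/eqP: e; rewrite n0 mul0n muln_eq0 (gtn_eqF d_gt0) orbF => /eqP ->.
  by apply: dvdn_leq => //; rewrite -(Gauss_dvdl _ cop) -e dvdn_mulr.
apply: dvdn_leq => //; rewrite -(@Gauss_dvdr _ `|numq q|) ?e ?dvdn_mull //.
by rewrite coprime_sym.
Qed.

Lemma height_add p q : (height (p + q) <= height p * height q)%N.
Proof.
have dp : (denq p)%:~R != 0 :> rat by rewrite intr_eq0 denq_neq0.
have dq : (denq q)%:~R != 0 :> rat by rewrite intr_eq0 denq_neq0.
have -> : p + q = (numq p * denq q + numq q * denq p)%:~R / (denq p * denq q)%:~R.
  rewrite intrD !intrM !numqE; move: (denq p)%:~R (denq q)%:~R dp dq => a b a0 b0.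
  by field; rewrite a0 b0.
apply: leq_trans (height_frac _ _) _; first by rewrite mulf_neq0 ?denq_neq0.
rewrite /height; move: (numq p) (denq p) (numq q) (denq q) => a b c d; nia.
Qed.

Lemma height_mul p q : (height (p * q) <= height p * height q)%N.
Proof.
have -> : p * q = (numq p * numq q)%:~R / (denq p * denq q)%:~R.
  by rewrite !intrM -mulf_div !divq_num_den.
apply: leq_trans (height_frac _ _) _; first by rewrite mulf_neq0 ?denq_neq0.
rewrite /height; move: (numq p) (denq p) (numq q) (denq q) => a b c d; nia.
Qed.

Lemma bits_height q m : (height q <= 2 ^ m)%N -> (bits q <= m.*2.+1)%N.
Proof.
rewrite /height /bits ltnS -addnn => h.
have le_log a : (a <= 2 ^ m)%N -> (trunc_log 2 a <= m)%N.
  by move=> /(leq_trunc_log 2); rewrite trunc_expnK.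
by apply: leq_add; apply: le_log; apply: leq_trans h; rewrite ?leq_addr ?leq_addl.
Qed.

Lemma height_bits q : (height q <= 2 ^ (bits q).+1)%N.
Proof.
rewrite /height /bits.
have := @trunc_log_ltn 2 `|numq q| isT; have := @trunc_log_ltn 2 `|denq q| isT.
move: `|numq q|%N (trunc_log 2 _) `|denq q|%N (trunc_log 2 _) => a x b y.
rewrite -addSn -addnS expnD !expnS.
have := expn_gt0 2 x; have := expn_gt0 2 y => /=.
move: (2 ^ x)%N (2 ^ y)%N => X Y; nia.
Qed.

Lemma rat_le_bits q : q <= 2 ^+ (bits q).+1.
Proof.
apply: (@le_trans _ _ (height q)%:R); last by rewrite -natrX ler_nat height_bits.
have [q0|q0] := leP q 0; first exact: le_trans q0 (ler0n _ _).
apply: (@le_trans _ _ (numq q)%:~R).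
  rewrite numqE ler_peMr ?(ltW q0) // -[1]/(1%:~R) ler_int.
  by have := denq_gt0 q; lia.
rewrite -[(height q)%:R]/((height q)%:~R) ler_int /height; lia.
Qed.

Lemma bits_nat (n : nat) : (bits n%:R <= n.+1)%N.
Proof.
rewrite /bits -[n%:R]/(n%:~R) numq_int denq_int /= ?addn0 ltnS.
have /ltnW/(leq_trunc_log 2)/leq_trans := ltn_expl n (isT : 1 < 2)%N.
by apply; rewrite trunc_expnK.
Qed.

(** * Running times *)

Lemma dsize_gt1 d : (1 < dsize d)%N.
Proof. by elim: d => //= a; lia. Qed.

Lemma dsize_runs p x y t : runs p x y t -> (dsize y <= t)%N.
Proof. elim => //= *; lia. Qed.

Section Computable.
Variables (X : Type) (dom : X -> Prop) (s : X -> nat).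
Implicit Types (F H A B : X -> data) (m n : X -> nat).

(** The base is at least 2, so constants, sums and products are all absorbed by raising the
    exponent. *)
Definition poly_bounded m := exists c, forall x, dom x -> (m x <= (s x).+2 ^ c)%N.

(* Running times are measured against the fixed scale [s] and not against the size
   of the argument, so that exponents do not grow along a sequence of calls. *)
Definition computable F H := exists p c, forall x, dom x ->
  exists2 t, runs p (F x) (H x) t & (t <= (s x).+2 ^ c)%N.

Lemma poly_bounded_le m n :
  (forall x, dom x -> (m x <= n x)%N) -> poly_bounded n -> poly_bounded m.
Proof. by move=> le [c cn]; exists c => x /[dup] /le /leq_trans h /cn /h. Qed.

Lemma poly_bounded_const k : poly_bounded (fun=> k).
Proof.
exists k => x _; apply: leq_trans (ltnW (ltn_expl k (isT : 1 < 2)%N)) _.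
by case: k => // k; rewrite leq_exp2r.
Qed.

Lemma poly_bounded_scale : poly_bounded s.
Proof. by exists 1%N => x _; rewrite expn1 -addn2 leq_addr. Qed.

Lemma poly_bounded_add m n :
  poly_bounded m -> poly_bounded n -> poly_bounded (fun x => m x + n x)%N.
Proof.
move=> [c cm] [d dn]; exists (c + d).+1 => x dx.
rewrite expnS expnD; have := cm x dx; have := dn x dx.
have := expn_gt0 (s x).+2 c; have := expn_gt0 (s x).+2 d => /=.
move: (_ ^ c)%N (_ ^ d)%N (m x) (n x) => a b u v; nia.
Qed.

Lemma poly_bounded_mul m n :
  poly_bounded m -> poly_bounded n -> poly_bounded (fun x => m x * n x)%N.
Proof.
by move=> [c cm] [d dn]; exists (c + d)%N => x dx; rewrite expnD leq_mul ?cm ?dn.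
Qed.

Lemma poly_bounded_exp k m : poly_bounded m -> poly_bounded (fun x => m x ^ k)%N.
Proof.
move=> pm; elim: k => [|k IH]; first exact: poly_bounded_const.
apply: poly_bounded_le (poly_bounded_mul pm IH) => x _; by rewrite expnS.
Qed.

Lemma poly_bounded_S m : poly_bounded m -> poly_bounded (fun x => (m x).+1).
Proof.
move=> pm; apply: poly_bounded_le (poly_bounded_add pm (poly_bounded_const 1)) => x _.
by rewrite addn1.
Qed.

Lemma computable_size F H : computable F H -> poly_bounded (fun x => dsize (H x)).
Proof.
move=> [p [c pc]]; exists c => x /pc[t r]; exact: leq_trans (dsize_runs r).
Qed.

Lemma computable_timeP F H p m : poly_bounded m ->
  (forall x, dom x -> exists2 t, runs p (F x) (H x) t & (t <= m x)%N) ->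
  computable F H.
Proof.
move=> [c mc] h; exists p, c => x dx; have [t r le] := h x dx.
by exists t => //; apply: leq_trans le (mc x dx).
Qed.

Lemma eq_computable F H H' : (forall x, dom x -> H x = H' x) ->
  computable F H -> computable F H'.
Proof. by move=> e [p [c pc]]; exists p, c => x dx; rewrite -e //; apply: pc. Qed.

Lemma computable_seq F A H : computable F A -> computable A H -> computable F H.
Proof.
move=> [p [c pc]] [q [d qd]].
apply: (@computable_timeP _ _ (Seq p q) (fun x => ((s x).+2 ^ c + (s x).+2 ^ d).+1)).
  by apply/poly_bounded_S/poly_bounded_add; [exists c | exists d].
move=> x dx; have [t r lt] := pc x dx; have [t' r' lt'] := qd x dx.
by exists (t + t').+1; [apply: RunSeq r r' | rewrite ltnS leq_add].
Qed.

Lemma computable_cell F A B : computable F A -> computable F B ->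
  computable F (fun x => Cell (A x) (B x)).
Proof.
move=> [p [c pc]] [q [d qd]].
apply: (@computable_timeP _ _ (Both p q) (fun x => ((s x).+2 ^ c + (s x).+2 ^ d).+1)).
  by apply/poly_bounded_S/poly_bounded_add; [exists c | exists d].
move=> x dx; have [t r lt] := pc x dx; have [t' r' lt'] := qd x dx.
by exists (t + t').+1; [apply: RunBoth r r' | rewrite ltnS leq_add].
Qed.

Lemma computable_op o F A : computable F A ->
  poly_bounded (fun x => dsize (op_eval o (A x))) ->
  computable F (fun x => op_eval o (A x)).
Proof.
move=> cA pb; apply: computable_seq (cA) _.
apply: (@computable_timeP _ _ (Op o) (fun x => (dsize (A x) + dsize (op_eval o (A x))).+1)).
  exact/poly_bounded_S/poly_bounded_add/pb/(computable_size cA).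
by move=> x dx; eexists; first exact: RunOp.
Qed.

Lemma computable_id F : poly_bounded (fun x => dsize (F x)) -> computable F F.
Proof.
move=> pb; apply: (@computable_timeP _ _ (Op Id) (fun x => (dsize (F x) + dsize (F x)).+1)).
  exact/poly_bounded_S/poly_bounded_add.
by move=> x dx; eexists; first exact: RunOp.
Qed.

Lemma computable_const d F A : computable F A -> computable F (fun=> d).
Proof.
by move=> cA; apply: (@computable_op (Const d) _ _ cA); apply: poly_bounded_const.
Qed.

Lemma computable_fst F A B :
  computable F (fun x => Cell (A x) (B x)) -> computable F A.
Proof.
move=> cAB; apply: (@computable_op Fst _ _ cAB).
by apply: poly_bounded_le (computable_size cAB) => x _ /=; rewrite -addnS leq_addr.
Qed.

Lemma computable_snd F A B :
  computable F (fun x => Cell (A x) (B x)) -> computable F B.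
Proof.
move=> cAB; apply: (@computable_op Snd _ _ cAB).
by apply: poly_bounded_le (computable_size cAB) => x _ /=; rewrite -addSn leq_addl.
Qed.

Lemma computable_iscell F A : computable F A ->
  computable F (fun x => op_eval IsCell (A x)).
Proof.
move=> cA; apply: computable_op (cA) _.
by apply: poly_bounded_le (poly_bounded_const 10) => x _; case: (A x).
Qed.

Lemma computable_leq F (a b : X -> rat) :
  computable F (fun x => Num (a x)) -> computable F (fun x => Num (b x)) ->
  computable F (fun x => dbool (a x <= b x)).
Proof.
move=> ca cb; apply: (@computable_op Leq _ _ (computable_cell ca cb)).
by apply: poly_bounded_le (poly_bounded_const 10) => x _ /=; case: (_ <= _).
Qed.

Lemma computable_add F (a b : X -> rat) :
  computable F (fun x => Num (a x)) -> computable F (fun x => Num (b x)) ->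
  computable F (fun x => Num (a x + b x)).
Proof.
move=> ca cb; apply: (@computable_op Add _ _ (computable_cell ca cb)).
have := poly_bounded_add (computable_size ca) (computable_size cb).
move=> /(poly_bounded_mul (poly_bounded_const 2))/poly_bounded_S/poly_bounded_S.
apply: poly_bounded_le => x _ /=; rewrite mul2n; apply: bits_height.
apply: leq_trans (height_add _ _) _.
by rewrite expnD leq_mul ?height_bits.
Qed.

Lemma computable_mul F (a b : X -> rat) :
  computable F (fun x => Num (a x)) -> computable F (fun x => Num (b x)) ->
  computable F (fun x => Num (a x * b x)).
Proof.
move=> ca cb; apply: (@computable_op Mul _ _ (computable_cell ca cb)).
have := poly_bounded_add (computable_size ca) (computable_size cb).
move=> /(poly_bounded_mul (poly_bounded_const 2))/poly_bounded_S/poly_bounded_S.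
apply: poly_bounded_le => x _ /=; rewrite mul2n; apply: bits_height.
apply: leq_trans (height_mul _ _) _.
by rewrite expnD leq_mul ?height_bits.
Qed.

End Computable.

Lemma poly_bounded_sub X X' (g : X' -> X) (dom : X -> Prop) (dom' : X' -> Prop) s m :
  (forall y, dom' y -> dom (g y)) ->
  poly_bounded dom s m -> poly_bounded dom' (s \o g) (m \o g).
Proof. by move=> h [c cm]; exists c => y /h; apply: cm. Qed.

Lemma computable_sub X X' (g : X' -> X) (dom : X -> Prop) (dom' : X' -> Prop) s F H :
  (forall y, dom' y -> dom (g y)) ->
  computable dom s F H -> computable dom' (s \o g) (F \o g) (H \o g).
Proof. by move=> h [p [c cm]]; exists p, c => y /h; apply: cm. Qed.

(** Each branch has to work only where the test selects it. In the loop this restricts the calls for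
    nets and aggregation to [alpha] nonzero. *)
Lemma computable_if X (dom : X -> Prop) s F B H :
  computable dom s F B ->
  computable (fun x => dom x /\ truth (B x)) s F H ->
  computable (fun x => dom x /\ ~~ truth (B x)) s F H ->
  computable dom s F H.
Proof.
move=> [b [cb bP]] [p [cp pP]] [q [cq qP]].
apply: (@computable_timeP _ _ _ _ _ (If b p q)
  (fun x => ((s x).+2 ^ cb + ((s x).+2 ^ cp + (s x).+2 ^ cq)).+1)).
  by apply/poly_bounded_S/poly_bounded_add;
    [exists cb | apply: poly_bounded_add; [exists cp | exists cq]].
move=> x dx; have [t r lt] := bP x dx.
have [t' r' lt'] : exists2 t', runs (if truth (B x) then p else q) (F x) (H x) t'
    & (t' <= (s x).+2 ^ cp + (s x).+2 ^ cq)%N.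
  case: ifPn => Bx.
    by have [t' r' h] := pP x (conj dx Bx); exists t' => //; apply: leq_trans h (leq_addr _ _).
  by have [t' r' h] := qP x (conj dx Bx); exists t' => //; apply: leq_trans h (leq_addl _ _).
by exists (t + t').+1; [apply: RunIf r r' | rewrite ltnS leq_add].
Qed.

(** * Loops *)

(** Pairs of an instance and a step index. Computability over such pairs, measured by the scale of
    the instance alone, expresses bounds that are uniform over the iterations. *)
Definition iter_dom X (dom : X -> Prop) (m : X -> nat) (y : X * nat) :=
  dom y.1 /\ (y.2 < m y.1)%N.

Lemma poly_bounded_iter X (dom : X -> Prop) s m n : poly_bounded dom s m ->
  poly_bounded (iter_dom dom n) (s \o fst) (fun y => m y.1).
Proof. by apply: (@poly_bounded_sub _ _ fst) => y []. Qed.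

(** The bounds on state, test and body do not depend on the step index, so the total cost is the
    number of steps times a single polynomial, and nothing compounds. *)
Lemma computable_while X (dom : X -> Prop) s (F : X -> data) (m : X -> nat)
    (St B : X -> nat -> data) :
  poly_bounded dom s m ->
  poly_bounded (iter_dom dom (S \o m)) (s \o fst) (fun y => dsize (St y.1 y.2)) ->
  computable (iter_dom dom (S \o m)) (s \o fst)
    (fun y => St y.1 y.2) (fun y => B y.1 y.2) ->
  (forall x j, dom x -> (j <= m x)%N -> truth (B x j) = (j < m x)%N) ->
  computable (iter_dom dom m) (s \o fst)
    (fun y => St y.1 y.2) (fun y => St y.1 y.2.+1) ->
  computable dom s F (fun x => St x 0%N) ->
  computable dom s F (fun x => St x (m x)).
Proof.
move=> pm [e eP] [q [c qP]] Bt [p [d pP]] /computable_seq; apply.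
(* One iteration costs a test and a body; the last summand pays for the final state, which enters
   the cost of stopping. *)
pose T x := ((s x).+2 ^ c + ((s x).+2 ^ d + (s x).+2 ^ e)).+1%N.
have pT : poly_bounded dom s T.
  by apply/poly_bounded_S/poly_bounded_add;
    [exists c | apply: poly_bounded_add; [exists d | exists e]].
apply: (@computable_timeP _ _ _ _ _ (While q p) (fun x => (m x).+1 * T x)%N).
  exact/poly_bounded_mul/pT/poly_bounded_S.
move=> x dx.
suff H k : (k <= m x)%N -> exists2 t,
    runs (While q p) (St x (m x - k)%N) (St x (m x)) t & (t <= k.+1 * T x)%N.
  by have := H (m x) (leqnn _); rewrite subnn.
elim: k => [_|k IH lk].
  rewrite subn0 mul1n.
  have [t r lt] := qP (x, m x) (conj dx (ltnSn _)).
  have := eP (x, m x) (conj dx (ltnSn _)) => /= le.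
  exists (t + dsize (St x (m x))).+1.
    by apply: RunWhileStop r _; rewrite Bt // ltnn.
  by rewrite /T ltnS leq_add //; apply: leq_trans le (leq_addl _ _).
have lj : (m x - k.+1 < m x)%N by lia.
have [t r lt] := qP (x, m x - k.+1)%N (conj dx (leqW lj : (_ < (S \o m) _)%N)).
have [t' r' lt'] := pP (x, m x - k.+1)%N (conj dx lj).
have [t2 r2 lt2] := IH (ltnW lk).
exists (t + t' + t2).+1.
  apply: RunWhileStep r _ r' _; first by rewrite Bt // ltnW.
  by rewrite /= (_ : (m x - k.+1).+1 = m x - k)%N //; lia.
rewrite mulSn -addSn leq_add // /T ltnS leq_add //.
exact: leq_trans lt' (leq_addr _ _).
Qed.

Lemma dsize_enc_seq l : dsize (enc_seq l) = (\sum_(d <- l) (dsize d).+1).+2.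
Proof. by elim: l => [|d l IH]; rewrite ?big_nil // big_cons /= IH; lia. Qed.

Lemma size_enc_seq l : (size l <= dsize (enc_seq l))%N.
Proof. by rewrite dsize_enc_seq -sum1_size leqW // leqW // leq_sum. Qed.

Lemma dsize_enc_take j l : (dsize (enc_seq (take j l)) <= dsize (enc_seq l))%N.
Proof. by rewrite -{2}(cat_take_drop j l) !dsize_enc_seq big_cat /= !ltnS leq_addr. Qed.

Lemma dsize_enc_drop j l : (dsize (enc_seq (drop j l)) <= dsize (enc_seq l))%N.
Proof. by rewrite -{2}(cat_take_drop j l) !dsize_enc_seq big_cat /= !ltnS leq_addl. Qed.

Lemma dsize_enc_seq_le b l :
  all (fun d => dsize d <= b)%N l -> (dsize (enc_seq l) <= (size l * b.+1).+2)%N.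
Proof.
rewrite dsize_enc_seq !ltnS; elim: l => [|d l IH] /=; first by rewrite big_nil.
by case/andP=> db /IH; rewrite big_cons; lia.
Qed.

Lemma dsize_enc_nth j l : (dsize (nth (Num 0) l j) <= dsize (enc_seq l))%N.
Proof.
have [lj|lj] := ltnP j (size l); last first.
  by rewrite nth_default // dsize_enc_seq.
rewrite dsize_enc_seq (big_nth (Num 0)) big_mkord (bigD1 (Ordinal lj)) //=; lia.
Qed.

Lemma catrev_take (T : Type) (x0 : T) (l m : seq T) j : (j < size l)%N ->
  catrev (take j.+1 l) m = nth x0 l j :: catrev (take j l) m.
Proof. by move=> lj; rewrite (take_nth x0) // -cats1 catrevE rev_cat /= -catrevE. Qed.

Section Folds.
Variables (X : Type) (dom : X -> Prop) (s : X -> nat) (F : X -> data).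
Implicit Types (l : X -> seq data).

(** The list is consumed from its head, [A x j] being the accumulator after [j] entries. The body is
    asked for in the form of an implication, so that a caller receives the current entry and the
    accumulator as computable data and combines them by the closure lemmas. *)
Lemma computable_fold l (A : X -> nat -> data) :
  poly_bounded (iter_dom dom (S \o size \o l)) (s \o fst) (fun y => dsize (A y.1 y.2)) ->
  (let C := computable (iter_dom dom (size \o l)) (s \o fst)
     (fun y => Cell (nth (Num 0) (l y.1) y.2) (A y.1 y.2)) in
   C (fun y => Cell (nth (Num 0) (l y.1) y.2) (A y.1 y.2)) -> C (fun y => A y.1 y.2.+1)) ->
  computable dom s F (fun x => Cell (enc_seq (l x)) (A x 0%N)) ->
  computable dom s F (fun x => A x (size (l x))).
Proof.
move=> pA body0 init.
have pl : poly_bounded dom s (fun x => dsize (enc_seq (l x))).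
  exact: computable_size (computable_fst init).
have /body0 body : computable (iter_dom dom (size \o l)) (s \o fst)
    (fun y => Cell (nth (Num 0) (l y.1) y.2) (A y.1 y.2))
    (fun y => Cell (nth (Num 0) (l y.1) y.2) (A y.1 y.2)).
  apply/computable_id/poly_bounded_S/poly_bounded_add.
    by apply: poly_bounded_le (poly_bounded_iter _ pl) => y _; apply: dsize_enc_nth.
  by case: pA => k kA; exists k => y [dy lt]; apply: kA; split=> //; apply: leqW.
pose St x j := Cell (enc_seq (drop j (l x))) (A x j).
suff /computable_snd : computable dom s F (fun x => St x (size (l x))) by [].
have pSt (m : X -> nat) : (forall x, dom x -> (m x <= (size (l x)).+1)%N) ->
    poly_bounded (iter_dom dom m) (s \o fst) (fun y => dsize (St y.1 y.2)).
  move=> hm; have sub y : iter_dom dom m y -> iter_dom dom (S \o size \o l) y.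
    by case=> dy lt; split=> //; apply: leq_trans lt (hm _ dy).
  apply/poly_bounded_S/poly_bounded_add.
    by apply: poly_bounded_le (poly_bounded_iter _ pl) => y _; apply: dsize_enc_drop.
  by case: pA => c cA; exists c => y /sub; apply: cA.
have cSt m : (forall x, dom x -> (m x <= (size (l x)).+1)%N) ->
    computable (iter_dom dom m) (s \o fst) (fun y => St y.1 y.2) (fun y => St y.1 y.2).
  by move=> hm; apply/computable_id/pSt.
(* An encoded list is a cell exactly when it is nonempty, so [IsCell] on the remaining list is the
   loop test. *)
apply: (@computable_while _ _ _ _ (size \o l) St
    (fun x j => op_eval IsCell (enc_seq (drop j (l x))))).
- by apply: poly_bounded_le pl => x _; apply: size_enc_seq.
- exact: pSt.
- apply: computable_iscell.
  by apply: (computable_fst (B := fun y => A y.1 y.2)); apply: cSt.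
- move=> x j dx /= le; have [lt|ge] := ltnP j (size (l x)).
    by rewrite (drop_nth (Num 0)).
  by rewrite drop_oversize.
- have c1 := cSt (size \o l) (fun x _ => leqnSn _).
  have c2 : computable (iter_dom dom (size \o l)) (s \o fst) (fun y => St y.1 y.2)
      (fun y => Cell (Cell (nth (Num 0) (l y.1) y.2) (enc_seq (drop y.2.+1 (l y.1))))
                  (A y.1 y.2)).
    apply: eq_computable c1 => -[x j] [dx /= lt].
    by rewrite /St (drop_nth (Num 0)).
  have cl := computable_fst c2.
  apply: computable_cell; first exact: computable_snd cl.
  apply: computable_seq body.
  exact: computable_cell (computable_fst cl) (computable_snd c2).
- by apply: eq_computable init => x _; rewrite /St drop0.
Qed.

(** Entries can only be moved from the front of one list to the front of another, which reverses
    them; reversal and concatenation are obtained from this. *)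
Lemma computable_catrev l l' :
  computable dom s F (fun x => Cell (enc_seq (l x)) (enc_seq (l' x))) ->
  computable dom s F (fun x => enc_seq (catrev (l x) (l' x))).
Proof.
move=> c; have pl := computable_size (computable_fst c).
have pl' := computable_size (computable_snd c).
pose A x j := enc_seq (catrev (take j (l x)) (l' x)).
apply: (@eq_computable _ _ _ _ (fun x => A x (size (l x)))).
  by move=> x _; rewrite /A take_size.
apply: computable_fold.
- apply: poly_bounded_le (poly_bounded_iter _ (poly_bounded_add pl pl')) => -[x j] [/= dx lt].
  rewrite /A catrevE; apply: leq_trans (leq_add (dsize_enc_take j _) (leqnn _)).
  by rewrite /= !dsize_enc_seq big_cat big_rev /= addSn addnS addSn addnS !ltnS !leqW.
- move=> C cA; apply: eq_computable cA => -[x j] [/= dx lt].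
  by rewrite /A (catrev_take (Num 0)).
- by apply: eq_computable c => x dx; rewrite /A take0.
Qed.

Lemma computable_rev l : computable dom s F (fun x => enc_seq (l x)) ->
  computable dom s F (fun x => enc_seq (rev (l x))).
Proof.
move=> c; apply: computable_catrev.
exact: computable_cell c (computable_const (Num 0) c).
Qed.

Lemma dsize_counters a n c : (a + n <= c)%N ->
  (dsize (enc_seq [seq enc_nat i | i <- rev (iota a n)]) <= (n * c.+3).+2)%N.
Proof.
move=> le; rewrite -{2}(size_iota a n) -size_rev -(size_map enc_nat).
apply: dsize_enc_seq_le; rewrite all_map; apply/allP => i /=.
rewrite mem_rev mem_iota => /andP[_ lt]; rewrite ltnS.
by apply: leq_trans (bits_nat i) _; lia.
Qed.

(** Putting a running counter in front of a list yields its values in decreasing order. The final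
    counter also provides the length of [l], hence the number of vertices. *)
Lemma computable_counters l (c : X -> nat) : poly_bounded dom s c ->
  computable dom s F (fun x => Cell (enc_seq (l x)) (enc_nat (c x))) ->
  computable dom s F (fun x => Cell (enc_nat (c x + size (l x)))
    (enc_seq [seq enc_nat i | i <- rev (iota (c x) (size (l x)))])).
Proof.
move=> pc cl.
pose A x j := Cell (enc_nat (c x + j))
  (enc_seq [seq enc_nat i | i <- rev (iota (c x) j)]).
apply: (@computable_fold l A).
- have pl := computable_size (computable_fst cl).
  pose d x := (c x + dsize (enc_seq (l x)))%N.
  have pd : poly_bounded dom s (fun x => (d x).+3 + (dsize (enc_seq (l x)) * (d x).+3).+2)%N.
    have pd' := poly_bounded_S (poly_bounded_S (poly_bounded_S (poly_bounded_add pc pl))).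
    apply: poly_bounded_add; first exact: pd'.
    by do 2!apply: poly_bounded_S; apply: poly_bounded_mul; [exact: pl | exact: pd'].
  apply: poly_bounded_le (poly_bounded_iter _ (poly_bounded_S pd)) => -[x j] [/= dx lt].
  rewrite ltnS.
  have le : (j <= dsize (enc_seq (l x)))%N.
    by apply: leq_trans (size_enc_seq _).
  have le' : (c x + j <= d x)%N by rewrite leq_add2l.
  apply: leq_add.
    by rewrite ltnS; apply: leq_trans (bits_nat _) _; lia.
  apply: leq_trans (dsize_counters le') _.
  by rewrite !ltnS leq_mul.
- move=> C cA; rewrite /A; have cA2 := computable_snd cA; have cn := computable_fst cA2.
  have c1 : C (fun y => enc_nat (c y.1 + y.2.+1)).
    have := computable_add cn (computable_const (Num 1) cn).
    by apply: eq_computable => y _; rewrite /enc_nat addnS natr1.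
  apply: computable_cell c1 _.
  have := computable_cell cn (computable_snd cA2).
  apply: eq_computable => -[x j] _.
  have iotaSr a n : iota a n.+1 = rcons (iota a n) (a + n)%N by rewrite -addn1 iotaD cats1.
  by rewrite iotaSr rev_rcons.
- have c0 := computable_cell (computable_snd cl) (computable_const (Num 0) cl).
  by apply: eq_computable (computable_cell (computable_fst cl) c0) => x dx; rewrite /A addn0.
Qed.

(** Provides the labelling of the last partition, with a single cluster. *)
Lemma computable_zeros l : computable dom s F (fun x => enc_seq (l x)) ->
  computable dom s F (fun x => enc_seq (nseq (size (l x)) (Num 0))).
Proof.
move=> cl; apply: (@computable_fold l (fun x j => enc_seq (nseq j (Num 0)))).
- have pl := computable_size cl.
  have p3 := poly_bounded_mul pl (poly_bounded_const dom s 3).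
  have := poly_bounded_iter (S \o size \o l) (poly_bounded_S (poly_bounded_S p3)).
  apply: poly_bounded_le => -[x j] [/= dx lt]; apply: (leq_trans (@dsize_enc_seq_le 2 _ _)).
    by rewrite all_nseq orbT.
  by rewrite size_nseq !ltnS leq_mul2r; apply: leq_trans (size_enc_seq _).
- move=> C cA; have c2 := computable_snd cA.
  exact: computable_cell (computable_const (Num 0) c2) c2.
- exact: computable_cell cl (computable_const (Num 0) cl).
Qed.

(** Here [l] serves as a unary counter: with the rows of the adjacency matrix for [l], a labelling
    of [G + N] is cut down to the vertices of [G]. *)
Lemma computable_take l l' : (forall x, dom x -> size (l x) <= size (l' x))%N ->
  computable dom s F (fun x => Cell (enc_seq (l x)) (enc_seq (l' x))) ->
  computable dom s F (fun x => enc_seq (take (size (l x)) (l' x))).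
Proof.
move=> le cl.
pose A x j := Cell (enc_seq (drop j (l' x))) (enc_seq (rev (take j (l' x)))).
suff /computable_snd /computable_rev c : computable dom s F (fun x => A x (size (l x))).
  by apply: eq_computable c => x dx; rewrite revK.
apply: computable_fold.
- have pl := computable_size (computable_snd cl).
  have := poly_bounded_iter (S \o size \o l) (poly_bounded_S (poly_bounded_add pl pl)).
  apply: poly_bounded_le => -[x j] [/= dx lt]; rewrite ltnS leq_add ?dsize_enc_drop //.
  by rewrite dsize_enc_seq big_rev -dsize_enc_seq dsize_enc_take.
- move=> C cA; have c2 := computable_snd cA; have c1 := computable_fst c2.
  have c3 : C (fun y => Cell (nth (Num 0) (l' y.1) y.2) (enc_seq (drop y.2.+1 (l' y.1)))).
    apply: eq_computable c1 => -[x j] [/= dx lt].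
    by rewrite (drop_nth (Num 0)) //; apply: leq_trans (le x dx).
  apply: computable_cell (computable_snd c3) _.
  have := computable_cell (computable_fst c3) (computable_snd c2).
  apply: eq_computable => -[x j] [/= dx lt].
  rewrite (take_nth (Num 0)) ?rev_rcons //.
  exact: leq_trans (le x dx).
- have c0 := computable_cell (computable_snd cl) (computable_const (Num 0) cl).
  apply: eq_computable (computable_cell (computable_fst cl) c0) => x dx.
  by rewrite /A drop0 take0.
Qed.

End Folds.

(** * Sums of edge weights and calls of given programs *)

Lemma height_sum (I : Type) (r : seq I) (f : I -> rat) (g : I -> nat) :
  (forall i, height (f i) <= 2 ^ g i)%N ->
  (height (\sum_(i <- r) f i) <= 2 ^ (\sum_(i <- r) g i))%N.
Proof.
move=> fg; elim: r => [|i r IH]; first by rewrite !big_nil.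
rewrite !big_cons expnD; apply: leq_trans (height_add _ _) _.
by rewrite leq_mul ?fg.
Qed.

Lemma height_exp q j : (height (q ^+ j) <= 2 ^ ((bits q).+1 * j).+1)%N.
Proof.
elim: j => [|j IH]; first by rewrite expr0 muln0.
rewrite exprS mulnS -addnS expnD; apply: leq_trans (height_mul _ _) _.
by rewrite leq_mul ?height_bits.
Qed.

Definition enc_row (r : seq rat) : data := enc_seq [seq Num q | q <- r].

(** The logarithms of the heights add up, and their sum is dominated by the encoding of the row; so
    all partial sums remain of linear bit-size. *)
Lemma height_row_sum r : (height (\sum_(q <- r) q) <= 2 ^ dsize (enc_row r))%N.
Proof.
have := height_sum r (f := id) height_bits.
move/leq_trans; apply; rewrite leq_exp2l // dsize_enc_seq big_map /=.
by do 2!apply: leqW; apply: leq_sum => q _; rewrite ltnS leqW.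
Qed.

Lemma height_matrix_sum M :
  (height (\sum_(r <- M) \sum_(q <- r) q) <= 2 ^ dsize (enc_seq (map enc_row M)))%N.
Proof.
have := height_sum M height_row_sum.
move/leq_trans; apply; rewrite leq_exp2l // dsize_enc_seq big_map /=.
by do 2!apply: leqW; apply: leq_sum => q _.
Qed.

Section Sums.
Variables (X : Type) (dom : X -> Prop) (s : X -> nat) (F : X -> data).

Lemma computable_row_sum (r : X -> seq rat) (a : X -> rat) :
  computable dom s F (fun x => Cell (enc_row (r x)) (Num (a x))) ->
  computable dom s F (fun x => Num (a x + \sum_(q <- r x) q)).
Proof.
move=> c.
suff : computable dom s F
    (fun x => Num (a x + \sum_(q <- take (size (map Num (r x))) (r x)) q)).
  by apply: eq_computable => x _; rewrite size_map take_size.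
apply: (@computable_fold _ _ _ _ (fun x => map Num (r x))
  (fun x j => Num (a x + \sum_(q <- take j (r x)) q))).
- have p := poly_bounded_S (computable_size c).
  have := poly_bounded_S (poly_bounded_mul (poly_bounded_const dom s 2) p).
  move/(poly_bounded_iter (S \o size \o (fun x => map Num (r x)))).
  apply: poly_bounded_le => -[x j] _ /=; rewrite ltnS mul2n.
  have le : (height (a x + \sum_(q <- take j (r x)) q)
      <= 2 ^ (dsize (Num (a x)) + dsize (enc_row (r x))))%N.
    apply: leq_trans (height_add _ _) _; rewrite expnD leq_mul ?height_bits //.
    apply: leq_trans (height_row_sum _) _.
    by rewrite leq_exp2l // /enc_row map_take dsize_enc_take.
  by apply: leq_trans (bits_height le) _ => /=; lia.
- move=> C cA; have c1 := computable_snd cA.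
  have c2 : C (fun y => Num (nth 0 (r y.1) y.2)).
    apply: eq_computable (computable_fst cA) => -[x j] [/= dx].
    by rewrite size_map => lt; rewrite (nth_map 0).
  apply: eq_computable (computable_add c1 c2) => -[x j] [/= dx].
  by rewrite size_map => lt; rewrite (take_nth 0) // -cats1 big_cat big_seq1 addrA.
- by apply: eq_computable c => x _; rewrite take0 big_nil addr0.
Qed.

End Sums.

Section Calls.
Variables (X : Type) (dom : X -> Prop) (s : X -> nat) (F : X -> data).

Lemma computable_matrix_sum (M : X -> seq (seq rat)) :
  computable dom s F (fun x => enc_seq (map enc_row (M x))) ->
  computable dom s F (fun x => Num (\sum_(r <- M x) \sum_(q <- r) q)).
Proof.
move=> c.
suff : computable dom s F
    (fun x => Num (\sum_(r <- take (size (map enc_row (M x))) (M x)) \sum_(q <- r) q)).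
  by apply: eq_computable => x _; rewrite size_map take_size.
apply: (@computable_fold _ _ _ _ (fun x => map enc_row (M x))
  (fun x j => Num (\sum_(r <- take j (M x)) \sum_(q <- r) q))).
- have p := poly_bounded_S (computable_size c).
  have := poly_bounded_S (poly_bounded_mul (poly_bounded_const dom s 2) p).
  move/(poly_bounded_iter (S \o size \o (fun x => map enc_row (M x)))).
  apply: poly_bounded_le => -[x j] _ /=; rewrite ltnS mul2n.
  have le : (height (\sum_(r <- take j (M x)) \sum_(q <- r) q)
      <= 2 ^ (dsize (enc_seq (map enc_row (M x)))))%N.
    apply: leq_trans (height_matrix_sum _) _.
    by rewrite leq_exp2l // map_take dsize_enc_take.
  by apply: leq_trans (bits_height le) _; rewrite doubleS.
- move=> C cA.
  have /computable_row_sum : C (fun y =>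
      Cell (enc_row (nth [::] (M y.1) y.2))
        (Num (\sum_(r <- take y.2 (M y.1)) \sum_(q <- r) q))).
    apply: eq_computable cA => -[x j] [/= dx].
    by rewrite size_map => lt; rewrite (nth_map [::]).
  apply: eq_computable => -[x j] [/= dx].
  by rewrite size_map => lt; rewrite (take_nth [::]) // -cats1 big_cat big_seq1.
- apply: eq_computable (computable_cell c (computable_const (Num 0) c)) => x _.
  by rewrite take0 big_nil.
Qed.

(** The cost of a given program is polynomial in the size of its own argument; it becomes polynomial
    in the fixed scale because the argument is computable, hence of polynomial size. *)
Lemma computable_call p c (A B : X -> data) :
  (forall x, dom x -> exists2 t, runs p (A x) (B x) t & (t <= c * dsize (A x) ^ c)%N) ->
  computable dom s F A -> computable dom s F B.
Proof.
move=> pP cA; apply: computable_seq (cA) _.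
apply: computable_timeP pP.
apply: poly_bounded_mul (poly_bounded_const _ _ _) _.
exact: poly_bounded_exp (computable_size cA).
Qed.

End Calls.

(** * Labellings *)

(** Counts downwards along the enumeration, to match the list that [computable_counters]
    produces. *)
Definition fresh (T : finType) (a : nat) (t : T) : nat := (a + (#|T| - (enum_rank t).+1))%N.

Lemma map_fresh (T : finType) a : map (@fresh T a) (enum T) = rev (iota a #|T|).
Proof.
apply: (@eq_from_nth _ 0%N); first by rewrite size_map size_rev size_iota cardE.
move=> i; rewrite size_map -cardE => lt.
have [t0 _] : exists t0 : T, true.
  by have := leq_ltn_trans (leq0n i) lt; case/card_gt0P => t _; exists t.
rewrite (nth_map t0) -?cardE // nth_rev ?size_iota // nth_iota; last first.
  by rewrite ltn_subrL (leq_ltn_trans _ lt).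
rewrite /fresh; congr (_ + (_ - _.+1))%N.
have -> : nth t0 (enum T) i = enum_val (Ordinal lt) by rewrite (enum_val_nth t0).
by rewrite enum_valK.
Qed.

Lemma fresh_inj (T : finType) a : injective (@fresh T a).
Proof.
move=> t u /eqP; rewrite /fresh eqn_add2l eqn_sub2lE ?ltn_ord // eqSS.
by move=> /eqP /val_inj /enum_rank_inj.
Qed.

(** The labels of [G] stay below [2 * #|T|], so the net vertices become singleton clusters and the
    clusters of [G] are unchanged. *)
Definition extend_label (T U : finType) (lab : T -> nat) (x : T + U) : nat :=
  match x with inl v => lab v | inr t => fresh (2 * #|T|) t end.

Lemma enum_sum (T U : finType) :
  enum ((T + U)%type : finType) = map inl (enum T) ++ map inr (enum U).
Proof. by rewrite !enumT [in LHS]unlock. Qed.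

Lemma enc_labels_sum (T U : finType) (L : T + U -> nat) :
  enc_labels L = enc_seq ([seq enc_nat (L (inl v)) | v <- enum T]
                       ++ [seq enc_nat (L (inr t)) | t <- enum U]).
Proof. by rewrite /enc_labels /enc_fun enum_sum map_cat -!map_comp. Qed.

Lemma enc_labels_extend (T U : finType) (lab : T -> nat) :
  enc_labels (@extend_label T U lab) =
  enc_seq (catrev (rev [seq enc_nat (lab v) | v <- enum T])
                  [seq enc_nat i | i <- rev (iota (2 * #|T|) #|U|)]).
Proof. by rewrite enc_labels_sum catrevE revK -map_fresh -map_comp. Qed.

Lemma enc_labels_fresh (T : finType) :
  enc_labels (@fresh T 0) = enc_seq [seq enc_nat i | i <- rev (iota 0 #|T|)].
Proof. by rewrite -map_fresh -map_comp. Qed.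

Lemma dsize_enc_labels (T : finType) (lab : T -> nat) b : (forall v, lab v < b)%N ->
  (dsize (enc_labels lab) <= (#|T| * b.+2).+2)%N.
Proof.
move=> lt; rewrite cardE -(size_map (fun v => enc_nat (lab v))).
apply: dsize_enc_seq_le; rewrite all_map; apply/allP => v _ /=.
by rewrite ltnS; apply: leq_trans (bits_nat _) (lt v).
Qed.

(** * The program *)

(** Each edge is counted twice. This is a bound on all distances of a connected graph that can be
    read off the adjacency matrix without computing shortest paths. *)
Definition total_weight (R : numDomainType) (T : finType) (G : wgraph R T) : R :=
  \sum_u \sum_v (if edge G u v then wt G u v else 0).

Definition matrix_rows (T : finType) (G : wgraph rat T) : seq (seq rat) :=
  [seq [seq (if edge G u v then wt G u v else 0) | v <- enum T] | u <- enum T].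

Lemma enc_graph_rows (T : finType) (G : wgraph rat T) :
  enc_graph G = enc_seq (map enc_row (matrix_rows G)).
Proof.
rewrite /enc_graph /enc_fun /matrix_rows; congr (enc_seq _); rewrite -[RHS]map_comp.
by apply: eq_map => u; congr (enc_seq _); rewrite -[RHS]map_comp.
Qed.

Lemma size_rows (T : finType) (G : wgraph rat T) : size (map enc_row (matrix_rows G)) = #|T|.
Proof. by rewrite size_map size_map cardE. Qed.

Lemma total_weight_rows (T : finType) (G : wgraph rat T) :
  total_weight G = \sum_(r <- matrix_rows G) \sum_(q <- r) q.
Proof.
rewrite big_map big_enum; apply: eq_bigr => u _.
by rewrite big_map big_enum.
Qed.

Definition inst_gamma I : rat := 2 * inst_beta I * (2 * inst_alpha I + 1).

(* The covering radius of the net for clusters of diameter [D'] is [inst_kappa I * D']. *)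
Definition inst_kappa I : rat := 2 * inst_alpha I * inst_beta I.

Definition net_scale I j : rat := inst_kappa I * inst_gamma I ^+ j.

(** From level [k] on, the constant labelling stands for the partition with the single cluster
    [V]. *)
Definition truncated_label (T : finType) (lab : nat -> T -> nat) k i : T -> nat :=
  if (i < k)%N then lab i else fun=> 0%N.

(** * The loop and its cost, for given labels, nets and aggregation solutions *)

Section Program.
Variables (K : instance -> Prop) (nets : net_family) (k : instance -> nat).
Variable lab : forall I, nat -> inst_vertex I -> nat.
Variable L : forall I j, (inst_vertex I + net_vertex (nets I (net_scale I j)))%type -> nat.
Arguments lab : clear implicits.
Arguments L : clear implicits.

Hypothesis nets_computable : nets_poly_time K nets.
Hypothesis k_spec : forall I j, K I -> (j <= k I)%N ->
  (total_weight (inst_graph I) + 1 <= inst_gamma I ^+ j) = (k I <= j)%N.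
Hypothesis k_le : forall I, K I -> (k I <= (bits (total_weight (inst_graph I) + 1)).+2)%N.
Hypothesis scale_gt0 : forall I j, K I -> (j < k I)%N -> inst_alpha I != 0 ->
  0 < net_scale I j.
Hypothesis lab_lt : forall I j v, K I -> (j <= k I)%N -> (lab I j v < 2 * #|inst_vertex I|)%N.
Hypothesis lab0 : forall I, lab I 0%N = fresh 0.
Hypothesis lab_stay : forall I j, inst_alpha I == 0 -> lab I j.+1 = lab I j.
Hypothesis lab_step : forall I j, inst_alpha I != 0 -> lab I j.+1 = L I j \o inl.

(** The input for level [j], in the format of [aggregation_poly_time]. *)
Definition agg_data I j : data :=
  Cell (enc_instance I) (Cell (Num (net_scale I j))
    (Cell (enc_net (nets I (net_scale I j)))
      (Cell (enc_labels (@extend_label _ (net_vertex (nets I (net_scale I j))) (lab I j)))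
        (Num (inst_gamma I ^+ j))))).

Hypothesis L_computable : exists p c, forall I j,
  [/\ K I, (j < k I)%N & inst_alpha I != 0] ->
  exists2 t, runs p (agg_data I j) (enc_labels (L I j)) t &
    (t <= c * dsize (agg_data I j) ^ c)%N.

Let s I := dsize (enc_instance I).
(** The part of the state that is computed once: the stopping threshold, the growth factor, the
    factor of the covering radius and the first label available to net vertices. *)
Let env I := Cell (enc_instance I) (Cell (Num (total_weight (inst_graph I) + 1))
  (Cell (Num (inst_gamma I)) (Cell (Num (inst_kappa I)) (enc_nat (2 * #|inst_vertex I|))))).
Let history I j := [seq enc_labels (lab I i) | i <- rev (iota 0 j)].
Let state I j := Cell (env I)
  (Cell (Num (inst_gamma I ^+ j)) (Cell (enc_labels (lab I j)) (enc_seq (history I j)))).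

Lemma card_inst_le I : (#|inst_vertex I| <= s I)%N.
Proof.
rewrite /s /enc_instance /= enc_graph_rows.
apply: leq_trans (leqW (leq_addr _ _)); apply: leq_trans (size_enc_seq _).
by rewrite size_rows.
Qed.

Lemma computable_rows Y (dom : Y -> Prop) s' F (g : Y -> instance) :
  computable dom s' F (fun y => enc_instance (g y)) ->
  computable dom s' F (fun y => enc_seq (map enc_row (matrix_rows (inst_graph (g y))))).
Proof.
move=> c; apply: eq_computable (computable_fst c) => y _; exact: enc_graph_rows.
Qed.

Lemma computable_env : computable K s enc_instance
  (fun I => Cell (enc_labels (lab I 0%N)) (env I)).
Proof.
have cI : computable K s enc_instance enc_instance.
  exact: computable_id (poly_bounded_scale _ _).
have cnum q A : computable K s enc_instance A -> computable K s enc_instance (fun=> Num q).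
  exact: computable_const.
have crow := computable_rows cI.
have c0 := cnum 0 _ cI.
have := computable_counters (poly_bounded_const K s 0) (computable_cell crow c0).
move=> cc; have cn := computable_fst cc.
have clab : computable K s enc_instance (fun I => enc_labels (lab I 0%N)).
  apply: eq_computable (computable_snd cc) => I _.
  by rewrite lab0 enc_labels_fresh size_rows.
have cpar := computable_snd cI; have ca := computable_fst cpar.
have cb := computable_fst (computable_snd cpar).
have c2 := cnum 2 _ cI; have c1 := cnum 1 _ cI.
apply: computable_cell clab _; apply: computable_cell cI _.
apply: computable_cell.
  apply: computable_add c1.
  apply: eq_computable (computable_matrix_sum crow) => I _.
  by rewrite total_weight_rows.
apply: computable_cell.
  exact: computable_mul (computable_mul c2 cb) (computable_add (computable_mul c2 ca) c1).
apply: computable_cell; first exact: computable_mul (computable_mul c2 ca) cb.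
apply: eq_computable (computable_mul c2 cn) => I _.
by rewrite /enc_nat add0n size_rows natrM.
Qed.

Lemma k_bounded : poly_bounded K s k.
Proof.
have := computable_size (computable_fst (computable_snd (computable_snd computable_env))).
by move/poly_bounded_S; apply: poly_bounded_le => I /k_le.
Qed.

(** The bound comes from what the state means and not from the cost of the steps: labels are below
    [2 * #|V|], the power of [gamma] has bit-size linear in [j], and [j] is at most [k], itself
    polynomial by [k_bounded]. *)
Lemma state_bounded : poly_bounded (iter_dom K (S \o k)) (s \o fst)
  (fun y => dsize (state y.1 y.2)).
Proof.
have pk := k_bounded.
have penv := computable_size (computable_snd computable_env).
have pgam := computable_size
  (computable_fst (computable_snd (computable_snd (computable_snd computable_env)))).
have pn : poly_bounded K s (fun I => #|inst_vertex I|).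
  by apply: poly_bounded_le (poly_bounded_scale _ _) => I _; apply: card_inst_le.
have plab : poly_bounded K s (fun I => (#|inst_vertex I| * (2 * #|inst_vertex I|).+2).+2).
  do 2!apply: poly_bounded_S; apply: poly_bounded_mul (pn) _.
  by do 2!apply: poly_bounded_S; apply: poly_bounded_mul (pn); apply: poly_bounded_const.
have dlab I j : K I -> (j <= k I)%N -> (dsize (enc_labels (lab I j))
    <= (#|inst_vertex I| * (2 * #|inst_vertex I|).+2).+2)%N.
  by move=> KI jk; apply: dsize_enc_labels => v; apply: lab_lt.
apply/poly_bounded_S/poly_bounded_add; first exact: (poly_bounded_iter _ penv).
apply/poly_bounded_S/poly_bounded_add.
  have := poly_bounded_S (poly_bounded_mul pgam pk).
  move/(poly_bounded_mul (poly_bounded_const K s 2)).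
  move/poly_bounded_S/poly_bounded_S/(poly_bounded_iter (S \o k)).
  apply: poly_bounded_le => -[I j] [/= KI jk]; rewrite ltnS mul2n.
  apply: bits_height; apply: leq_trans (height_exp _ _) _.
  by rewrite leq_exp2l // ltnS leq_mul.
apply/poly_bounded_S/poly_bounded_add.
  by apply: poly_bounded_le (poly_bounded_iter _ plab) => -[I j] [/= KI jk]; apply: dlab.
have := poly_bounded_S (poly_bounded_S (poly_bounded_mul pk (poly_bounded_S plab))).
move/(poly_bounded_iter (S \o k)).
apply: poly_bounded_le => -[I j] [/= KI jk].
apply: leq_trans (dsize_enc_seq_le _) _.
  rewrite all_map; apply/allP => i /=; rewrite mem_rev mem_iota => /andP[_ ij].
  by apply: dlab => //; lia.
by rewrite size_map size_rev size_iota !ltnS leq_mul.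
Qed.

Lemma computable_step : computable (iter_dom K k) (s \o fst)
  (fun y => state y.1 y.2) (fun y => state y.1 y.2.+1).
Proof.
set F := fun y => _; have cF : computable (iter_dom K k) (s \o fst) F F.
  apply: computable_id; case: state_bounded => c h; exists c => y [Ky lt]; apply: h.
  by split=> //; apply: leqW.
have cenv := computable_fst cF; have cI := computable_fst cenv.
have cgam := computable_fst (computable_snd (computable_snd cenv)).
have c1 := computable_snd cF; have cpow := computable_fst c1.
have clab := computable_fst (computable_snd c1).
have chist := computable_snd (computable_snd c1).
apply: computable_cell (cenv) _; apply: computable_cell.
  by apply: eq_computable (computable_mul cgam cpow) => y _; rewrite exprS.
apply: computable_cell; last first.
  apply: eq_computable (computable_cell clab chist) => -[I j] _.
  by rewrite /history -addn1 iotaD cats1 rev_rcons.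
have calpha := computable_fst (computable_snd cI).
have restrict (Q : instance * nat -> Prop) H :
    computable (iter_dom K k) (s \o fst) F H ->
    computable (fun y => iter_dom K k y /\ Q y) (s \o fst) F H.
  by apply: (@computable_sub _ _ id) => y [].
(* For [alpha = 0] the labels are kept and neither the net nor the aggregation program is called. *)
apply: (computable_if calpha); last first.
  apply: eq_computable (restrict _ _ clab) => -[I j] [_ /=].
  by rewrite negbK => al0; rewrite lab_stay.
set dom := fun y => _; have {}restrict H := restrict (fun y => truth (Num (inst_alpha y.1))) H.
move: cF cenv cI cpow clab calpha => /restrict cF /restrict cenv /restrict cI /restrict cpow
  /restrict clab /restrict calpha.
have ckap := computable_fst (computable_snd (computable_snd (computable_snd cenv))).
have c2n := computable_snd (computable_snd (computable_snd (computable_snd cenv))).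
have cscale := computable_mul ckap cpow.
have [p [c pP]] := nets_computable.
have cnet : computable dom (s \o fst) F (fun y => enc_net (nets y.1 (net_scale y.1 y.2))).
  apply: (computable_call (p := p) (c := c)) (computable_cell cI cscale).
  move=> [I j] [[/= KI jk] al]; have [y [t [r le /= e]]] := pP (I, net_scale I j)
    (conj KI (scale_gt0 KI jk al)).
  by exists t => //; rewrite -e.
have crow := computable_rows cI.
have pn : poly_bounded dom (s \o fst) (fun y => 2 * #|inst_vertex y.1|)%N.
  apply: (poly_bounded_mul (poly_bounded_const _ _ 2)).
  by apply: poly_bounded_le (poly_bounded_scale _ _) => y _; apply: card_inst_le.
have cext : computable dom (s \o fst) F (fun y => enc_labels (
    @extend_label _ (net_vertex (nets y.1 (net_scale y.1 y.2))) (lab y.1 y.2))).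
  have := computable_cell (computable_rev clab)
    (computable_snd (computable_counters pn (computable_cell cnet c2n))).
  move/computable_catrev; apply: eq_computable => y _.
  by rewrite enc_labels_extend size_map !cardE.
have cagg : computable dom (s \o fst) F (fun y => agg_data y.1 y.2).
  by do 3!apply: computable_cell => //; apply: computable_cell.
have [q [d qP]] := L_computable.
have cL : computable dom (s \o fst) F (fun y => enc_labels (L y.1 y.2)).
  by apply: (computable_call (p := q) (c := d)) cagg => -[I j] [[/= KI jk] al]; apply: qP.
have cL' : computable dom (s \o fst) F (fun y => enc_seq (
     [seq enc_nat (L y.1 y.2 (inl v)) | v <- enum (inst_vertex y.1)]
  ++ [seq enc_nat (L y.1 y.2 (inr t))
       | t <- enum (net_vertex (nets y.1 (net_scale y.1 y.2)))])).
  by apply: eq_computable cL => y _; rewrite enc_labels_sum.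
have := computable_cell crow cL' => /computable_take ct.
apply: eq_computable (ct _) => -[I j] [[/= KI jk] al].
  by rewrite size_rows lab_step // take_size_cat // size_map cardE.
by rewrite size_rows size_cat size_map cardE leq_addr.
Qed.

Lemma truth_dbool b : truth (dbool b) = b.
Proof. by rewrite /= pnatr_eq0; case: b. Qed.

Lemma computable_final : computable K s enc_instance (fun I => state I (k I)).
Proof.
apply: (@computable_while _ _ _ _ k state
  (fun I j => dbool (~~ (total_weight (inst_graph I) + 1 <= inst_gamma I ^+ j)))).
- exact: k_bounded.
- exact: state_bounded.
- have cs := computable_id state_bounded.
  have cW := computable_fst (computable_snd (computable_fst cs)).
  have cpow := computable_fst (computable_snd cs).
  have cB := computable_leq cW cpow.
  have cc Q d : computable (fun y => iter_dom K (S \o k) y /\ Q y) (s \o fst)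
      (fun y => state y.1 y.2) (fun=> d).
    by have := computable_const d cW; apply: (@computable_sub _ _ id) => y [].
  (* The negated comparison is obtained as a conditional with constant branches. *)
  apply: (computable_if cB).
    apply: eq_computable (cc _ (dbool false)) => y [_].
    by rewrite truth_dbool => ->.
  apply: eq_computable (cc _ (dbool true)) => y [_].
  by rewrite truth_dbool => /negPf ->.
- by move=> I j KI jk; rewrite truth_dbool k_spec // ltnNge.
- exact: computable_step.
- have cl := computable_fst computable_env; have ce := computable_snd computable_env.
  apply: computable_cell ce _.
  apply: computable_cell.
    by apply: eq_computable (computable_const (Num 1) cl) => I _; rewrite expr0.
  apply: computable_cell (cl) _.
  by apply: eq_computable (computable_const (Num 0) cl) => I _.
Qed.

Lemma computable_labels : @poly_time_solvable instance K enc_instance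
  (fun I y => y = enc_seq
    [seq enc_labels (truncated_label (lab I) (k I) i) | i <- iota 0 (k I).+1]).
Proof.
suff [p [c pP]] : computable K s enc_instance (fun I => enc_seq
    [seq enc_labels (truncated_label (lab I) (k I) i) | i <- iota 0 (k I).+1]).
  (* As the input size [s] is at least 2, [(s + 2) ^ c] is at most [(2 * s) ^ c], hence at most
     [2 ^ c * s ^ (2 ^ c)]: one number serves as factor and as exponent. *)
  exists p, (2 ^ c)%N => I /pP[t r le]; eexists; exists t; split; [exact: r | | by []].
  apply: leq_trans le _; have s_gt1 : (1 < s I)%N := dsize_gt1 _.
  apply: (@leq_trans ((2 * s I) ^ c)).
    by case: (c) => // d; rewrite leq_exp2r //; lia.
  by rewrite expnMn leq_mul // leq_exp2l // ltnW // ltn_expl.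
have cs := computable_final.
have crow := computable_rows (computable_fst (computable_fst cs)).
have chist := computable_snd (computable_snd (computable_snd cs)).
(* The history lists the levels [k - 1] down to [0]; the zero labelling for level [k] is put in
   front before reversing. *)
have := computable_rev (computable_cell (computable_zeros crow) chist
  : computable K s enc_instance (fun I => enc_seq (_ :: history I (k I)))).
apply: eq_computable => I _; congr (enc_seq _).
rewrite size_rows rev_cons /history -map_rev revK -addn1 iotaD add0n map_cat /= cats1.
congr rcons; last first.
  rewrite /truncated_label ltnn /enc_labels /enc_fun; congr (enc_seq _).
  by rewrite cardE; elim: (enum _) => //= v e <-.
by apply/eq_in_map => i; rewrite mem_iota /truncated_label => /andP[_ ->].
Qed.

End Program.

(** * Walks and distances *)

Section Walks.
Variables (R : realType) (T : finType) (G : wgraph R T).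
Implicit Types (u v : T) (p q : seq T) (r : R).

Lemma walk_length_ge0 u p : path (edge G) u p -> 0 <= walk_length G u p.
Proof.
by elim: p u => //= v p IH u /andP[e /IH h]; rewrite addr_ge0 // wt_ge0.
Qed.

Lemma walk_length_cat u p q :
  walk_length G u (p ++ q) = walk_length G u p + walk_length G (last u p) q.
Proof. by elim: p u => [|v p IH] u /=; rewrite ?add0r // IH addrA. Qed.

(** Closed subwalks are cut out; as weights are nonnegative, this does not increase the length. *)
Lemma walk_shorten u p : path (edge G) u p -> exists q,
  [/\ path (edge G) u q, last u q = last u p, uniq (u :: q) &
      walk_length G u q <= walk_length G u p].
Proof.
elim: p u => [|v p IH] u; first by exists [::].
case/andP=> e /IH[q [pq lq uq wq]].
have [|nu] := boolP (u \in v :: q); last first.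
  by exists (v :: q); split=> //=; [rewrite e | rewrite nu | rewrite lerD2l].
rewrite inE => /orP[/eqP uv|].
  by exists q; rewrite uv; split=> //=; rewrite (le_trans wq) // lerDr -{1}uv wt_ge0.
move=> uq'; move: pq lq uq wq; case/splitPr: uq' => p1 p2.
rewrite cat_path last_cat /= => /and3P[pp1 e1 pp2] lq /andP[_].
rewrite cat_uniq walk_length_cat /= => /and3P[_ _ uq] wq.
exists p2; split=> //; apply: le_trans (le_trans wq _); last by rewrite lerDr wt_ge0.
by rewrite addrA lerDr addr_ge0 ?walk_length_ge0 // wt_ge0.
Qed.

(** The form in which distance bounds are used from here on: an explicit walk instead of an infimum
    in the extended reals. *)
Definition reach u v r := exists p,
  [/\ path (edge G) u p, last u p = v & walk_length G u p <= r].

Lemma reach_le u v r r' : r <= r' -> reach u v r -> reach u v r'.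
Proof. by move=> le [p [pp lp wp]]; exists p; split=> //; apply: le_trans le. Qed.

Lemma reach_refl u r : 0 <= r -> reach u u r.
Proof. by exists [::]. Qed.

Lemma reach_edge u v : edge G u v -> reach u v (wt G u v).
Proof. by move=> e; exists [:: v]; rewrite /= e addr0. Qed.

Lemma reach_trans v u w r s : reach u v r -> reach v w s -> reach u w (r + s).
Proof.
move=> [p [pp <- wp]] [q [pq <- wq]]; exists (p ++ q).
by rewrite cat_path pp pq last_cat walk_length_cat lerD.
Qed.

Lemma reach_sym u v r : reach u v r -> reach v u r.
Proof.
case=> p [pp <-]; elim: p u r pp => [|w p IH] u r /=; first by move=> _; apply: reach_refl.
case/andP=> e pp wr; rewrite -[r](subrK (wt G u w)).
apply: reach_trans (IH _ _ pp _) _; first by rewrite lerBrDl.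
by rewrite wt_sym; apply: reach_edge; rewrite edge_sym.
Qed.

(** The infimum is attained: by [walk_shorten] only walks without repeated vertices matter, and
    these lie in the finite type of sequences of length at most [#|T|]. *)
Lemma dist_le u v r : (dist G u v <= r%:E)%E <-> reach u v r.
Proof.
split=> [le|[p [pp lp wp]]]; last first.
  apply: (@le_trans _ _ (walk_length G u p)%:E); last by rewrite lee_fin.
  by apply: ereal_inf_lbound; exists p.
have [[p0 [pp0 lp0]]|no] := pselect (exists p, path (edge G) u p /\ last u p = v); last first.
  suff e : dist G u v = +oo%E by move: le; rewrite e.
  apply/eqP; rewrite eq_le leey; apply: le_ereal_inf_tmp => x [p hp _].
  by case: no; exists p.
have size_le q : uniq (u :: q) -> (size q <= #|T|)%N.
  by move/card_uniqP => /= e; rewrite ltnW // -e max_card.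
have [q0 [pq0 lq0 /size_le sq0 _]] := walk_shorten pp0.
pose P (q : #|T|.-bseq T) := path (edge G) u q && (last u q == v).
have P0 : P (Bseq sq0) by rewrite /P /= pq0 lq0 lp0 /=.
case: (arg_minP (fun q : #|T|.-bseq T => walk_length G u q) P0) => q /andP[pq /eqP lq] min.
exists q; split=> //; rewrite -lee_fin; apply: le_trans le.
apply: le_ereal_inf_tmp => x [p [pp lp] <-]; rewrite lee_fin.
have [q' [pq' lq' /size_le sq' wq']] := walk_shorten pp.
by apply: le_trans wq'; apply: (min (Bseq sq')); rewrite /P /= pq' lq' lp /=.
Qed.

Lemma dist_ge0 u v : (0 <= dist G u v)%E.
Proof.
apply: le_ereal_inf_tmp => x [p [pp _] <-].
by rewrite lee_fin walk_length_ge0.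
Qed.

Lemma dist_set_le v (S : {set T}) r :
  (dist_set G v S <= r%:E)%E <-> exists2 u, u \in S & reach v u r.
Proof.
split=> [|[u uS /dist_le h]]; last exact: bigmin_inf uS h.
rewrite /dist_set; elim/big_ind: _ => [//|x y IHx IHy|u uS].
  by rewrite ge_min => /orP[/IHx|/IHy].
by move/dist_le => h; exists u.
Qed.

Lemma dist_set_fin v (S : {set T}) r : (dist_set G v S <= r%:E)%E ->
  exists2 m, dist_set G v S = m%:E & 0 <= m <= r.
Proof.
have : (0 <= dist_set G v S)%E.
  by rewrite /dist_set; apply: le_bigmin => // u _; apply: dist_ge0.
by case: (dist_set G v S) => // m; rewrite !lee_fin => m0 mr; exists m; rewrite ?m0.
Qed.

(** A walk without repeated vertices leaves each vertex at most once, by an edge that the sum over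
    this vertex counts. *)
Lemma connect_reach u v : connect (edge G) u v -> reach u v (total_weight G).
Proof.
case/connectP => p0 pp0 ->; have [p [pp <- up _]] := walk_shorten pp0.
exists p; split=> //; rewrite /total_weight.
pose W u := \sum_v (if edge G u v then wt G u v else 0).
have W0 x : 0 <= W x.
  by apply: sumr_ge0 => y _; case: ifP => // /wt_ge0.
have h x q : path (edge G) x q -> walk_length G x q <= \sum_(y <- x :: q) W y.
  elim: q x => [|y q IH] x /=; first by rewrite big_seq1.
  case/andP=> e /IH le; rewrite big_cons lerD // /W (bigD1 y) //= e lerDl.
  by apply: sumr_ge0 => z _; case: ifP => // /wt_ge0.
apply: le_trans (h _ _ pp) _; rewrite big_uniq //=.
rewrite [leRHS](bigID (mem (u :: p))) /= lerDl.
by apply: sumr_ge0 => x _; apply: W0.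
Qed.

End Walks.

Lemma reach_map (R : realType) (T U : finType) (G : wgraph R T) (H : wgraph R U) (h : T -> U) :
  (forall u v, edge G u v -> edge H (h u) (h v) /\ wt H (h u) (h v) <= wt G u v) ->
  forall u v r, reach G u v r -> reach H (h u) (h v) r.
Proof.
move=> hom u v r [p [pp <-]]; elim: p u r pp => [|w p IH] u r /=.
  by move=> _; apply: reach_refl.
case/andP=> /hom[e le] /IH {}IH wr; rewrite -[r](subrKC (wt H (h u) (h w))).
apply: reach_trans (reach_edge e) (IH _ _).
by rewrite lerBrDl (le_trans _ wr) // lerD2r.
Qed.

Lemma reach_induced (R : realType) (T : finType) (G : wgraph R T) (C : {set T}) u v r :
  reach (induced G C) u v r -> reach G u v r.
Proof. by apply: (@reach_map _ _ _ _ _ id) => x y /and3P[]. Qed.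

Section NetWalks.
Variables (R : realType) (T : finType) (G : wgraph R T) (N : dangling_net R T).
Local Notation H := (plus_net G N).

Lemma reach_inl u v r : reach G u v r -> reach H (inl u) (inl v) r.
Proof. exact: reach_map. Qed.

Lemma reach_inl_induced C u v r :
  reach (induced G C) u v r -> reach (induced H (inl @: C)) (inl u) (inl v) r.
Proof.
apply: reach_map => x y /and3P[e xC yC]; split=> //=.
by rewrite e !(imset_f inl).
Qed.

(* A detour through a net vertex returns to the anchor, so it can be cut. *)
Lemma reach_anchor (F : {set T + net_vertex N}) v t r :
  reach (induced H F) (inl v) (inr t) r ->
  reach (induced G (inl @^-1: F)) v (anchor t) (r - anchor_wt t).
Proof.
case=> p [pp lp wp].
(* The induction also meets walks that start at a net vertex [s]; these are replaced by walks from
   its anchor, except that an empty walk gives [s = t]. *)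
suff h x q L : path (edge (induced H F)) x q -> last x q = inr t ->
    walk_length (induced H F) x q <= L ->
    match x with
    | inl u => reach (induced G (inl @^-1: F)) u (anchor t) (L - anchor_wt t)
    | inr s => s = t \/ reach (induced G (inl @^-1: F)) (anchor s) (anchor t) (L - anchor_wt t)
    end by exact: h pp lp wp.
elim: q x L {p pp lp wp} => [|y q IH] x L /=.
  by move=> _ -> _; left.
move=> /andP[e pq] lq le; have wq := @walk_length_ge0 _ _ (induced H F) y q pq.
have {}IH L' := IH y L' pq lq; move: e IH le wq => {pq lq}.
case: x => [u|s]; case: y => [w|s'] //= /and3P[e uF wF] IH le wq.
- have {}IH := IH (L - wt G u w); rewrite -[_ - _](subrKC (wt G u w)).
  apply: (reach_trans (v := w)).
    by apply: reach_edge; rewrite /= e !inE uF wF.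
  by rewrite addrAC; apply: IH; rewrite lerBrDl.
- move/eqP: e => <-; have [|st|] := IH (L - anchor_wt s'); first by rewrite lerBrDl.
    by rewrite -st; apply: reach_refl; rewrite subr_ge0 (le_trans _ le) // lerDl.
  by apply: reach_le; rewrite lerD2r lerBlDl lerDr anchor_wt_ge0.
- right; rewrite (eqP e); have := IH (L - anchor_wt s); rewrite lerBrDl => /(_ le).
  by apply: reach_le; rewrite lerD2r lerBlDl lerDr anchor_wt_ge0.
Qed.

End NetWalks.

(** * Partitions given by labels *)

Section Labels.
Variables (T : finType) (lab : T -> nat).

Lemma partition_ofP : partition (partition_of lab) [set: T].
Proof. exact: preim_partitionP. Qed.

Lemma in_partition_of (C : {set T}) :
  C \in partition_of lab <-> exists v, C = [set u | lab u == lab v].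
Proof.
split=> [/imsetP[v _ ->]|[v ->]]; [exists v | apply/imsetP; exists v => //];
  by apply/setP => u; rewrite !inE eq_sym.
Qed.

Lemma pblock_partition_of v : pblock (partition_of lab) v = [set u | lab u == lab v].
Proof.
have /and3P[_ tP _] := partition_ofP.
by apply: def_pblock tP _ _; [apply/in_partition_of; exists v | rewrite inE].
Qed.

End Labels.

Lemma partition_of_inj (T : finType) (lab : T -> nat) : injective lab ->
  partition_of lab = [set [set v] | v : T].
Proof.
move=> inj; apply/setP => C; apply/idP/imsetP => [/in_partition_of[v ->]|[v _ ->]].
  by exists v => //; apply/setP => u; rewrite !inE (inj_eq inj).
by apply/in_partition_of; exists v; apply/setP => u; rewrite !inE (inj_eq inj).
Qed.

Lemma partition_of_const (T : finType) c : (0 < #|T|)%N ->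
  partition_of (fun _ : T => c) = [set [set: T]].
Proof.
case/card_gt0P => v _; apply/setP => C; rewrite inE.
apply/idP/eqP => [/in_partition_of[w ->]|->].
  by apply/setP => u; rewrite !inE eqxx.
by apply/in_partition_of; exists v; apply/setP => u; rewrite !inE eqxx.
Qed.

Lemma partition_of_card (T : finType) (l : T -> nat) : (#|partition_of l| <= #|T|)%N.
Proof. by rewrite -cardsT leq_imset_card. Qed.

Lemma partition_of_coarsen (T : finType) (l l' : T -> nat) :
  (forall u v, l u = l v -> l' u = l' v) ->
  forall U, U \in partition_of l -> exists2 U', U' \in partition_of l' & U \subset U'.
Proof.
move=> h U /in_partition_of[v ->]; exists [set u | l' u == l' v].
  by apply/in_partition_of; exists v.
by apply/fintype.subsetP => u; rewrite !inE => /eqP/h ->.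
Qed.

Lemma partition_of_inj_diam (R : realType) (T : finType) (G : wgraph R T) (l : T -> nat) D :
  injective l -> 0 <= D ->
  forall C, C \in partition_of l -> strong_diam_le G D C.
Proof.
move=> inj D0 C /in_partition_of[w ->] x y; rewrite !inE !(inj_eq inj).
by move=> /eqP -> /eqP ->; apply/dist_le/reach_refl.
Qed.

Lemma card_net_vertex (R : numDomainType) (T : finType) (N : dangling_net R T) :
  (#|net_vertex N| <= #|T|)%N.
Proof. exact: leq_card (@anchor_inj _ _ N). Qed.

(** * One step of aggregation *)

Section GoodNet.
Variables (R : realType) (T : finType) (G : wgraph R T) (alpha beta tau : R).
Hypothesis adm : admissible G alpha beta tau.

Lemma reach_lt1 u v r : reach G u v r -> r < 1 -> u = v.
Proof.
have [[_ _ _ [dmin _]] _ _ _] := adm.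
move=> /dist_le h lt; apply/eqP; apply: contraTT lt => /dmin le; rewrite -leNgt.
by rewrite -lee_fin (le_trans le).
Qed.

Lemma radius_ge0 D : 0 <= D -> (0 <= radius D alpha)%E.
Proof.
move=> D0; have [_ a0 _ _] := adm; rewrite /radius; case: ifP => // _.
by rewrite lee_fin divr_ge0.
Qed.

Section Step.
Variables (N : dangling_net R T) (D : R).
Hypothesis good : good_net G alpha beta tau D N.
Local Notation H := (plus_net G N).

Lemma net_dist v : exists2 m, dist_set H (inl v) (portals N) = m%:E & 0 <= m <= D.
Proof. by case: good => cov _ _; apply: dist_set_fin (cov v). Qed.

Lemma net_reach v m : dist_set H (inl v) (portals N) = m%:E ->
  exists t, reach H (inl v) (inr t) m.
Proof.
move=> e; have : (dist_set H (inl v) (portals N) <= m%:E)%E by rewrite e.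
by case/dist_set_le => _ /imsetP[t _ ->]; exists t.
Qed.

(** A closest portal of any vertex is itself counted by the sparsity of the net. *)
Lemma tau_ge1 : 0 <= D -> 1 <= tau.
Proof.
move=> D0; have [[/card_gt0P[v _] _ _ _] _ _ _] := adm; have [_ sp _] := good.
apply: le_trans (sp v); rewrite ler1n; have [m e _] := net_dist v.
have [t ht] := net_reach e; apply/card_gt0P; exists t; rewrite inE e.
apply: (@le_trans _ _ m%:E); first exact/dist_le.
by rewrite leeDl // radius_ge0.
Qed.

(** For [alpha = 0] the radius is infinite, so sparsity counts all portals. A covering radius below
    1 forces a portal anchored at each vertex, since a walk shorter than 1 ends where it starts. *)
Lemma card_le_tau : alpha = 0 -> D < 1 -> #|T|%:R <= tau.
Proof.
move=> a0 D1; have [[/card_gt0P[v _] _ _ _] _ _ _] := adm; have [_ sp _] := good.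
apply: le_trans (sp v); rewrite ler_nat.
have -> : [set t | (dist H (inl v) (inr t) <=
    dist_set H (inl v) (portals N) + radius D alpha)%E] = [set: net_vertex N].
  apply/setP => t; rewrite !inE; have [m -> _] := net_dist v.
  by rewrite /radius a0 eqxx addey // leey.
suff anc (x : T) : exists t : net_vertex N, anchor t = x.
  rewrite cardsT; apply: (@leq_trans #|codom (@anchor _ _ N)|); last first.
    by rewrite card_codom //; apply: anchor_inj.
  by apply/subset_leq_card/fintype.subsetP => x _; have [t <-] := anc x; apply: codom_f.
have [m e /andP[m0 mD]] := net_dist x; have [t ht] := net_reach e; exists t; symmetry.
(* [reach_anchor] speaks of induced subgraphs; here it is applied to the whole vertex set. *)
have /reach_anchor/reach_induced h : reach (induced H [set: _]) (inl x) (inr t) m.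
  by apply: (reach_map (h := id)) ht => a b ab; split=> //; apply/and3P; rewrite !inE.
apply: reach_lt1 h _.
by rewrite (le_lt_trans _ D1) // lerBlDr (le_trans mD) // lerDl anchor_wt_ge0.
Qed.

Section Instance.
Variables (D' : R) (lab : T -> nat).
Hypothesis D'0 : 0 < D'.
Hypothesis lab_lt : forall v, (lab v < 2 * #|T|)%N.
Hypothesis lab_diam : forall C, C \in partition_of lab -> strong_diam_le G D' C.
Let elab : T + net_vertex N -> nat := extend_label lab.

Lemma extend_instance : aggregation_instance H D' (partition_of elab).
Proof.
have fr t : (2 * #|T| <= fresh (2 * #|T|) (t : net_vertex N))%N by rewrite leq_addr.
split=> //; first exact: partition_ofP.
move=> C /in_partition_of[[v|t] ->]; last first.
  have single x : elab x == elab (inr t) -> x = inr t.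
    case: x => [v|s] /=; last by move/eqP/fresh_inj ->.
    by rewrite ltn_eqF // (leq_trans (lab_lt v) (fr t)).
  move=> x y; rewrite !inE => /single -> /single ->.
  by apply/dist_le/reach_refl/ltW.
have -> : [set u | elab u == elab (inl v)] = inl @: [set u | lab u == lab v].
  apply/setP => -[u|t]; rewrite !inE /=.
    by rewrite mem_imset ?inE //; apply: inl_inj.
  apply/idP/imsetP => [|[u _]//].
  by rewrite gtn_eqF // (leq_trans (lab_lt v) (fr t)).
move=> _ _ /imsetP[x xC ->] /imsetP[y yC ->].
apply/dist_le/reach_inl_induced/dist_le/lab_diam => //.
by apply/in_partition_of; exists v.
Qed.

Variables (f : {set T + net_vertex N} -> T + net_vertex N).
Hypothesis sol : aggregation_solution H beta D' (partition_of elab) (portals N) f.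
Let target v := f (pblock (partition_of elab) (inl v)).

Lemma target_reach u : exists t m,
  [/\ target u = inr t, dist_set H (inl u) (portals N) = m%:E, m <= D &
      reach (induced H [set x | f (pblock (partition_of elab) x) == inr t])
        (inl u) (inr t) (m + beta * D')].
Proof.
have [port dst] := sol; have [m e /andP[_ mD]] := net_dist u.
have /imsetP[t _ et] : target u \in portals N.
  apply: port; apply: pblock_mem; have /and3P[/eqP -> _ _] := partition_ofP elab.
  by rewrite inE.
exists t, m; split=> //; apply/dist_le.
by move: (dst (inl u)); rewrite /= -/(target u) et e EFinD.
Qed.

Variable lab' : T -> nat.
Hypothesis lab'E : forall u v, (lab' u == lab' v) = (target u == target v).

(** All vertices of a cluster have the same portal [t]. Their walks to [t] stay in the fibre of [t]
    and can be cut so as to avoid net vertices, so each reaches the anchor of [t] inside the cluster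
    within [D + beta * D']. *)
Lemma target_diam C : C \in partition_of lab' ->
  strong_diam_le G (2 * (D + beta * D')) C.
Proof.
move=> /in_partition_of[w ->]; have [t [_ [et _ _ _]]] := target_reach w.
have -> : [set u | lab' u == lab' w] =
    inl @^-1: [set x | f (pblock (partition_of elab) x) == inr t].
  by apply/setP => u; rewrite !inE lab'E et.
set C0 := (C in strong_diam_le _ _ C).
suff toanc u : u \in C0 -> reach (induced G C0) u (anchor t) (D + beta * D').
  move=> u v /toanc hu /toanc /reach_sym hv; apply/dist_le.
  by rewrite mulrDl mul1r; apply: reach_trans hu hv.
rewrite !inE => /eqP etu; have [t' [m [et' _ mD]]] := target_reach u.
move: et'; rewrite /target etu => -[<-] /reach_anchor.
by apply: reach_le; rewrite lerBlDr -addrA lerD // lerDl anchor_wt_ge0.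
Qed.

(** Clusters are counted by their portals. If [u] in the ball has portal [t], the distance from [v]
    to [t] is at most [rho] plus the distance from [u] to the net plus [beta * D']; going from [u]
    to the net costs at most [rho] more than from [v], which gives the excess
    [2 * rho + beta * D']. *)
Lemma target_sparse v rho : 0 < alpha -> D / alpha = 2 * rho + beta * D' ->
  #|[set C in partition_of lab' | C :&: ball G v rho%:E != set0]|%:R <= tau.
Proof.
move=> a0 eD; have [_ sp _] := good; apply: le_trans (sp v); rewrite ler_nat.
set S := [set t : net_vertex N | _].
apply: leq_trans (leq_imset_card (fun t => [set u | target u == inr t]) S).
apply: subset_leq_card.
apply/fintype.subsetP => C; rewrite inE => /andP[/in_partition_of[w ->] /set0Pn[u]].
rewrite !inE lab'E => /andP[/eqP uw /dist_le uv].
have [t [mu [et eu _ /reach_induced ht]]] := target_reach u.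
apply/imsetP; exists t; last by apply/setP => x; rewrite !inE lab'E -uw et.
rewrite inE; have [mv ev _] := net_dist v; have [t' ht'] := net_reach ev.
have le : mu <= rho + mv.
  rewrite -lee_fin -eu; apply/dist_set_le; exists (inr t'); first exact: imset_f.
  exact: reach_trans (reach_inl N uv) ht'.
rewrite ev /radius gt_eqF // -EFinD eD; apply/dist_le.
apply: reach_le (reach_trans (reach_inl N (reach_sym uv)) ht).
by lra.
Qed.

End Instance.
End Step.
End GoodNet.

(** * The hierarchy *)

Section Hierarchy.
Variables (R : realType) (T : finType) (G : wgraph R T) (alpha beta tau : R).
Hypothesis adm : admissible G alpha beta tau.

(** On a walk of length 1 between vertices at distance 1, the first edge has positive weight, so
    what remains is shorter than 1 and the first edge already ends at [v]. *)
Lemma unit_edge : (1 < #|T|)%N -> exists u v : T, [/\ u != v, edge G u v & wt G u v <= 1].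
Proof.
have [[_ pos _ [_ dmin]] _ _ _] := adm.
case/card_gt1P => x [y [_ _ xy]].
have [u [v [uv /eqP]]] : exists u v : T, u != v /\ dist G u v = 1%:E.
  by apply: dmin; exists x, y.
rewrite eq_le => /andP[/dist_le[p [pp lp wp]] _].
exists u, v; split=> //; case: p pp lp wp => [_ /= e|w p /=].
- by rewrite e eqxx in uv.
- case/andP=> e pp lp wp; suff <- : w = v by [].
  by apply: (reach_lt1 adm (r := 1 - wt G u w)); [exists p; split=> //; lra
    | have := pos _ _ e; lra].
- by rewrite e eqxx in uv.
- case/andP=> e pp lp wp; have wv : w = v.
    by apply: (reach_lt1 adm (r := 1 - wt G u w)); [exists p; split=> //; lra
      | have := pos _ _ e; lra].
  by rewrite -wv; have := walk_length_ge0 pp; lra.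
Qed.

(* Two vertices at distance 1 that form a cluster are sent to the same portal,
   which is anchored away from one of them. *)
Lemma beta_ge N D : (1 < #|T|)%N ->
  good_net G alpha beta tau D N ->
  1 <= beta + D.
Proof.
move=> /unit_edge[u [v [uv e w1]]] good.
(* Merges [v] with [u] and leaves all other vertices alone, so [D' = 1] bounds the strong
   diameters. *)
pose lab x : nat := enum_rank (if x == v then u else x).
have lab_lt x : (lab x < 2 * #|T|)%N.
  by apply: leq_trans (ltn_ord _) _; rewrite leq_pmull.
have lab_eq x y : lab x = lab y -> [\/ x = y, x = u /\ y = v | x = v /\ y = u].
  move=> /val_inj/enum_rank_inj.
  have [->|_] := eqVneq x v; have [->|_] := eqVneq y v => exy.
  - by apply: Or31.
  - by apply: Or33.
  - by apply: Or32.
  - by apply: Or31.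
have lab_diam C : C \in partition_of lab -> strong_diam_le G 1 C.
  case/in_partition_of => w -> x y xC yC; apply/dist_le.
  have euv : u \in [set z | lab z == lab w] -> v \in [set z | lab z == lab w] ->
      reach (induced G [set z | lab z == lab w]) u v 1.
    move=> uC vC; apply: reach_le w1 _.
    by apply: (@reach_edge _ _ (induced G _)); rewrite /= e uC vC.
  have /lab_eq[<-|[xu yv]|[xv yu]] : lab x = lab y.
    by move: xC yC; rewrite !inE => /eqP -> /eqP ->.
  - exact: reach_refl.
  - by move: xC yC; rewrite xu yv; apply: euv.
  - by move: xC yC; rewrite xv yu => vC uC; apply: reach_sym (euv uC vC).
have ins := extend_instance N ltr01 lab_lt lab_diam.
have [_ _ /(_ _ _ ins)[f sol]] := good.
have [t [m [et _ mD ht]]] := target_reach good sol u.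
have [t' [m' [et' _ mD' ht']]] := target_reach good sol v.
have tt' : t' = t.
  have elab : lab v = lab u by rewrite /lab eqxx (negPf uv).
  by move: et et'; rewrite !pblock_partition_of /= elab => -> [].
rewrite tt' in ht'; have wt0 := anchor_wt_ge0 t.
move: ht ht' => /reach_anchor/reach_induced hu /reach_anchor/reach_induced hv.
(* If [beta + D < 1], then [u] and [v] are both at distance less than 1 from the anchor of [t], so
   both are equal to it. *)
rewrite leNgt; apply/negP => lt; move/negP: uv; apply; apply/eqP.
by rewrite (reach_lt1 adm hu) ?(reach_lt1 adm hv) //; lra.
Qed.

Lemma total_weight_ge1 : (1 < #|T|)%N -> 1 <= total_weight G.
Proof.
case/card_gt1P => x [y [_ _ xy]]; have [[_ _ con _] _ _ _] := adm.
rewrite leNgt; apply: contraNN xy => lt; apply/eqP.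
by apply: (reach_lt1 adm) lt; apply: connect_reach.
Qed.

Lemma total_weight1 : #|T| = 1%N -> total_weight G = 0.
Proof.
case/fintype1 => x Tx; rewrite /total_weight big1 // => u _; rewrite big1 // => v _.
by rewrite (Tx u) (Tx v) edge_irr.
Qed.

(** For [alpha = 0] the covering radius [2 * alpha * beta * D'] would be 0, and nets are only
    provided for positive radii; the labels are kept instead. *)
Definition agg_step D' (lab lab' : T -> nat) : Prop :=
  if alpha == 0 then lab' = lab else exists N f,
    [/\ good_net G alpha beta tau (2 * alpha * beta * D') N,
        aggregation_solution (plus_net G N) beta D' (partition_of (extend_label lab))
          (portals N) f &
        forall v, lab' v =
          enum_rank (f (pblock (partition_of (extend_label lab)) (inl v)))].

Lemma radiusE D : radius D (8 * alpha + 4) = (D / (8 * alpha + 4))%:E.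
Proof. by rewrite /radius gt_eqF //; have [_ a0 _ _] := adm; lra. Qed.

Variables (k : nat) (lab : nat -> T -> nat).
Let gamma := 2 * beta * (2 * alpha + 1).
Hypothesis k_minimal : forall i, (i < k)%N -> gamma ^+ i < total_weight G + 1.

(** A graph with one vertex has total weight 0, so the stopping condition already holds at level
    0. *)
Lemma k_gt0 : (0 < k)%N -> (1 < #|T|)%N.
Proof.
move=> /k_minimal; rewrite expr0 => lt; have [[T0 _ _ _] _ _ _] := adm.
have [//|le] := ltnP 1 #|T|; have T1 : #|T| = 1%N by lia.
by move: lt; rewrite total_weight1 // add0r ltxx.
Qed.

Hypothesis beta_ge1 : (1 < #|T|)%N -> 1 <= beta.

Lemma gamma_ge2 : (0 < k)%N -> 2 <= gamma.
Proof.
move=> /k_gt0/beta_ge1 b1; have [_ a0 _ _] := adm; rewrite /gamma; nra.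
Qed.

Lemma gamma_exp_gt0 i : (i < k)%N -> 0 < gamma ^+ i.
Proof.
by move=> ik; apply: exprn_gt0; have := gamma_ge2 (leq_ltn_trans (leq0n i) ik); lra.
Qed.

Hypothesis lab_inj : injective (lab 0%N).
Hypothesis lab0_lt : forall v, (lab 0%N v < 2 * #|T|)%N.
Hypothesis tau1 : 1 <= tau.
Hypothesis tau_card : alpha = 0 -> #|T|%:R <= tau.
Hypothesis lab_step : forall i, (i < k)%N ->
  (forall v, (lab i v < 2 * #|T|)%N) ->
  (forall C, C \in partition_of (lab i) -> strong_diam_le G (gamma ^+ i) C) ->
  agg_step (gamma ^+ i) (lab i) (lab i.+1).

(** The three claims are proved together: the bounds on labels and diameters make level [i] a
    legitimate aggregation instance, and for [alpha = 0] level [i] is still the partition into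
    singletons. *)
Lemma labels_sparse i : (i <= k)%N ->
  [/\ forall v, (lab i v < 2 * #|T|)%N,
      sparse_partition G (gamma ^+ i) (8 * alpha + 4) tau (partition_of (lab i)) &
      alpha = 0 -> lab i = lab 0%N].
Proof.
have [_ a0 b0 _] := adm.
elim: i => [_|i IH ik].
  split=> //; split; first exact: partition_ofP.
    by apply: partition_of_inj_diam; rewrite ?expr0.
  move=> v; apply: le_trans tau1; rewrite radiusE expr0 lern1.
  (* The radius [1 / (8 * alpha + 4)] is below the minimum distance 1, so the ball meets only the
     cluster of its centre. *)
  have ball_sub u : u \in ball G v (1 / (8 * alpha + 4))%:E -> u = v.
    rewrite inE => /dist_le/(reach_lt1 adm); apply.
    by rewrite ltr_pdivrMr; lra.
  apply: (leq_trans _ (eq_leq (cards1 [set u | lab 0%N u == lab 0%N v]))).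
  apply/subset_leq_card/fintype.subsetP => C; rewrite !inE.
  case/andP=> /in_partition_of[w ->] /set0Pn[u]; rewrite in_setI => /andP[uw /ball_sub uv].
  by move: uw; rewrite uv inE => /eqP ->.
have [lt [_ diam _] al] := IH (ltnW ik).
have := lab_step ik lt diam; rewrite /agg_step; have [al0|aln0] := eqVneq alpha 0.
  move=> e; rewrite e; split=> //; rewrite (al al0); split; first exact: partition_ofP.
    apply: partition_of_inj_diam => //; apply: exprn_ge0.
    by rewrite /gamma !mulr_ge0 //; lra.
  move=> v; apply: le_trans (tau_card al0); rewrite ler_nat.
  apply: leq_trans (partition_of_card (lab 0%N)).
  by apply/subset_leq_card/fintype.subsetP => C; rewrite inE => /andP[].
have a_gt0 : 0 < alpha by rewrite lt_def aln0.
have g0 := gamma_exp_gt0 ik.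
case=> N [f [good sol labE]].
have D0 : 0 <= 2 * alpha * beta * gamma ^+ i by rewrite !mulr_ge0 // ltW.
have lab'E u v : (lab i.+1 u == lab i.+1 v) =
    (f (pblock (partition_of (extend_label (lab i))) (inl u))
      == f (pblock (partition_of (extend_label (lab i))) (inl v))).
  by rewrite !labE (inj_eq val_inj) (inj_eq enum_rank_inj).
split; last by move=> al0; rewrite al0 eqxx in aln0.
  (* Labels are ranks in [V + N], and [N] has at most [#|V|] vertices because anchors are
     distinct. *)
  move=> v; rewrite labE; apply: leq_trans (ltn_ord _) _.
  by rewrite card_sum mulSn mul1n leq_add2l card_net_vertex.
split; first exact: partition_ofP.
  (* With [D = 2 * alpha * beta * gamma ^+ i], the bound [2 * (D + beta * gamma ^+ i)] is exactly
     [gamma ^+ i.+1]. *)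
  move=> C CP; have := target_diam good sol lab'E CP.
  by congr strong_diam_le; rewrite exprS /gamma; ring.
(* The radius equals [beta * gamma ^+ i / 2], so both sides of the required identity are
   [2 * beta * gamma ^+ i]. *)
move=> v; rewrite radiusE; apply: (target_sparse good sol lab'E) => //.
rewrite exprS /gamma; field.
by rewrite gt_eqF //; lra.
Qed.

Hypothesis k_reached : total_weight G + 1 <= gamma ^+ k.

Lemma hierarchy_of_labels :
  hierarchy G gamma (8 * alpha + 4) tau k (fun i => partition_of (truncated_label lab k i)).
Proof.
have [[T0 _ con _] _ _ _] := adm.
have top : partition_of (truncated_label lab k k) = [set [set: T]].
  by rewrite /truncated_label ltnn partition_of_const.
split=> //.
(* For [k = 0] the first partition is also the last, so the singletons have to coincide with [{V}]:
   the total weight is then at most 0 and there is only one vertex. *)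
- rewrite /truncated_label; case: (posnP k) k_reached => [-> |k0 _].
    rewrite expr0 => le; have T1 : #|T| = 1%N.
      have [lt|] := ltnP 1 #|T|; last by lia.
      by exfalso; have := total_weight_ge1 lt; lra.
    by apply: partition_of_inj => x y _; have [z Tz] := fintype1 T1; rewrite (Tz x) (Tz y).
  exact: partition_of_inj.
- move=> i; rewrite leq_eqVlt => /orP[/eqP ->|ik]; last first.
    by have [_ + _] := labels_sparse (ltnW ik); rewrite /truncated_label ik.
  rewrite top; split.
  + by rewrite -top; apply: partition_ofP.
  + move=> C; rewrite inE => /eqP -> u v _ _; apply/dist_le.
    apply: (@reach_map _ _ _ G _ id); first by move=> x y e; rewrite /= e !inE.
    apply: reach_le (connect_reach (con u v)).
    by apply: le_trans k_reached; rewrite lerDl.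
  + move=> v; apply: le_trans tau1; rewrite lern1.
    apply: (leq_trans _ (eq_leq (cards1 [set: T]))).
    by apply/subset_leq_card/fintype.subsetP => C; rewrite inE => /andP[].
(* Vertices with the same label lie in one cluster of the extended partition and are therefore sent
   to the same portal. *)
- move=> i ik; apply: partition_of_coarsen => u v; rewrite /truncated_label ik.
  case: ifP => // ik1; have [lt [_ diam _] _] := labels_sparse (ltnW ik).
  have := lab_step ik lt diam; rewrite /agg_step; case: ifP => [_ -> //|_].
  case=> N [f [_ _ labE]] e; rewrite !labE !pblock_partition_of /=.
  by rewrite e.
Qed.

End Hierarchy.

(** * Proof of the theorem *)

(** Growth is only required for [1 < w], since otherwise [k = 0] works; for [w] the total weight
    plus 1, this is the case of at least two vertices, where [beta] is known to be at least 1. *)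
Lemma first_power (F : archiRealFieldType) (w g : F) : (1 < w -> 2 <= g) ->
  exists k, w <= g ^+ k /\ forall i, (i < k)%N -> g ^+ i < w.
Proof.
move=> wg; have ex : exists k, w <= g ^+ k.
  have [w1|/wg g2] := leP w 1; first by exists 0%N; rewrite expr0.
  have /ltW le := archi_boundP (normr_ge0 w).
  exists (Num.bound `|w|); apply: le_trans (ler_norm w) (le_trans le _).
  apply: (@le_trans _ _ (2 ^+ Num.bound `|w|)).
    by rewrite -natrX ler_nat ltnW // ltn_expl.
  by rewrite lerXn2r // nnegrE ?ler0n //; apply: le_trans g2.
case: (ex_minnP ex) => k wk min; exists k; split=> // i ik.
by rewrite ltNge; apply/negP => /min; rewrite leqNgt ik.
Qed.

Lemma fresh_lt (T : finType) (v : T) : (fresh 0 v < 2 * #|T|)%N.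
Proof.
have T0 : (0 < #|T|)%N by apply/card_gt0P; exists v.
by rewrite /fresh add0n; apply: (@leq_trans #|T|); rewrite ?leq_pmull // ltn_subrL.
Qed.

Lemma total_weight_gt1 (R : realType) (T : finType) (G : wgraph R T) (alpha beta tau : R) :
  admissible G alpha beta tau -> 1 < total_weight G + 1 -> (1 < #|T|)%N.
Proof.
move=> [[T0 _ _ _] _ _ _] lt; have [//|le] := ltnP 1 #|T|.
by move: lt; rewrite total_weight1 ?add0r ?ltxx //; lia.
Qed.

Lemma hierarchy_exists (R : realType) (T : finType) (G : wgraph R T) (alpha beta tau : R) :
  admissible G alpha beta tau ->
  (forall D : R, 0 < D -> exists N : dangling_net R T, good_net G alpha beta tau D N) ->
  exists (k : nat) (CC : nat -> {set {set T}}),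
    hierarchy G (2 * beta * (2 * alpha + 1)) (8 * alpha + 4) tau k CC.
Proof.
move=> adm nets; have [_ a0 b0 _] := adm.
have beta1 : (1 < #|T|)%N -> 1 <= beta.
  move=> T1; rewrite leNgt; apply/negP => lt.
  (* With this radius [beta + D] is [(1 + beta) / 2], still below 1, against [beta_ge]. *)
  have [|N good] := nets ((1 - beta) / 2); first by lra.
  by have := beta_ge adm T1 good; lra.
set gamma := 2 * beta * _.
have [|k [k_reached k_min]] := @first_power _ (total_weight G + 1) gamma.
  by move=> /(total_weight_gt1 adm)/beta1 b1; rewrite /gamma; nra.
have [|N0 good0] := nets (1 / 2); first by lra.
have tau1 : 1 <= tau by apply: (tau_ge1 adm good0); lra.
have tauT : alpha = 0 -> #|T|%:R <= tau by move=> ?; apply: (card_le_tau adm good0) => //; lra.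
(* Nets and solutions exist only for valid levels. A total successor function is chosen with a
   promise on those, and iterated; [labels_sparse] later shows that all levels are valid. *)
pose valid (x : nat * (T -> nat)) := [/\ (x.1 < k)%N, forall v, (x.2 v < 2 * #|T|)%N &
  forall C, C \in partition_of x.2 -> strong_diam_le G (gamma ^+ x.1) C].
have /choice[next nextP] x : exists l,
    valid x -> agg_step G alpha beta tau (gamma ^+ x.1) x.2 l.
  have [[ik lt diam]|] := pselect (valid x); last by exists x.2.
  rewrite /agg_step; case: eqP => [_|/eqP al0]; first by exists x.2.
  have g0 : 0 < gamma ^+ x.1 by apply: (gamma_exp_gt0 adm k_min beta1).
  have b1 : 1 <= beta.
    by apply: beta1; apply: (k_gt0 adm k_min); apply: leq_ltn_trans ik.
  have [|N good] := nets (2 * alpha * beta * gamma ^+ x.1).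
    by rewrite !mulr_gt0 //; [rewrite lt_def al0 | lra].
  have [_ _ /(_ _ _ (extend_instance N g0 lt diam))[f sol]] := good.
  eexists=> _; exists N, f; split=> //.
pose lab := nat_rect (fun=> T -> nat) (fresh 0) (fun i l => next (i, l)).
exists k, (fun i => partition_of (truncated_label lab k i)).
apply: hierarchy_of_labels => //.
- exact: fresh_inj.
- exact: fresh_lt.
- by move=> i ik lt diam; apply: (nextP (i, lab i)).
Qed.

(** * Rational instances: the labels computed by the loop satisfy the real statement *)

Section Algorithm.
Variables (R : realType) (K : instance -> Prop) (nets : net_family).
Hypothesis K_adm : forall I : instance, K I ->
  admissible (real_graph R (inst_graph I)) (ratr (inst_alpha I))
    (ratr (inst_beta I)) (ratr (inst_tau I)).
Hypothesis K_good : forall (I : instance) (D : rat), K I -> 0 < D ->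
  good_net (real_graph R (inst_graph I)) (ratr (inst_alpha I))
    (ratr (inst_beta I)) (ratr (inst_tau I)) (ratr D) (real_net R (nets I D)).

Definition real_gamma I : R := 2 * ratr (inst_beta I) * (2 * ratr (inst_alpha I) + 1).

Lemma ratr_gamma I j : ratr (inst_gamma I ^+ j) = real_gamma I ^+ j.
Proof. by rewrite rmorphXn /= !(rmorphM, rmorphD, rmorph1, rmorph_nat). Qed.

Lemma ratr_scale I j : ratr (net_scale I j) =
  2 * ratr (inst_alpha I) * ratr (inst_beta I) * real_gamma I ^+ j.
Proof. by rewrite rmorphM /= ratr_gamma !(rmorphM, rmorph_nat). Qed.

Lemma ratr_total_weight (T : finType) (G : wgraph rat T) :
  ratr (total_weight G) = total_weight (real_graph R G).
Proof.
rewrite /total_weight rmorph_sum; apply: eq_bigr => u _.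
rewrite rmorph_sum; apply: eq_bigr => v _ /=.
by case: ifP => _; rewrite ?rmorph0.
Qed.

Lemma inst_alpha_ge0 I : K I -> 0 <= inst_alpha I.
Proof. by move=> /K_adm[_ + _ _]; rewrite ler0q. Qed.

Lemma inst_beta_ge1 I : K I -> (1 < #|inst_vertex I|)%N -> 1 <= inst_beta I.
Proof.
move=> KI T1; rewrite leNgt; apply/negP => lt.
have D0 : 0 < (1 - inst_beta I) / 2 by lra.
have := beta_ge (K_adm KI) T1 (K_good KI D0).
by rewrite -rmorphD -(rmorph1 (@ratr R)) ler_rat; lra.
Qed.

Lemma inst_card I : K I -> 1 < total_weight (inst_graph I) + 1 -> (1 < #|inst_vertex I|)%N.
Proof.
move=> KI lt; apply: (total_weight_gt1 (K_adm KI)).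
by rewrite -ratr_total_weight -(rmorph1 (@ratr R)) -rmorphD ltr_rat.
Qed.

Lemma inst_gamma_ge2 I : K I -> (1 < #|inst_vertex I|)%N -> 2 <= inst_gamma I.
Proof.
move=> KI /(inst_beta_ge1 KI) b1; have := inst_alpha_ge0 KI; rewrite /inst_gamma; nra.
Qed.

Lemma levels_exist : exists k : instance -> nat, forall I, K I ->
  total_weight (inst_graph I) + 1 <= inst_gamma I ^+ k I /\
  forall i, (i < k I)%N -> inst_gamma I ^+ i < total_weight (inst_graph I) + 1.
Proof.
have /choice[k kP] : forall I, exists k, K I ->
    total_weight (inst_graph I) + 1 <= inst_gamma I ^+ k /\
    forall i, (i < k)%N -> inst_gamma I ^+ i < total_weight (inst_graph I) + 1.
  move=> I; have [KI|] := pselect (K I); last by exists 0%N.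
  have [|k hk] := @first_power _ (total_weight (inst_graph I) + 1) (inst_gamma I).
    by move=> /(inst_card KI)/(inst_gamma_ge2 KI).
  by exists k.
by exists k.
Qed.

Variable solve : forall x : agg_input nets,
  (inst_vertex (agg_inst x) + net_vertex (nets (agg_inst x) (agg_scale x)))%type -> nat.
Arguments solve : clear implicits.

Definition level_input I j (l : inst_vertex I -> nat) : agg_input nets :=
  @AggInput nets I (net_scale I j) (extend_label l) (inst_gamma I ^+ j).

Definition solved_label I : nat -> inst_vertex I -> nat :=
  nat_rect (fun=> inst_vertex I -> nat) (fresh 0) (fun j l =>
    if inst_alpha I == 0 then l else fun v => solve (level_input j l) (inl v)).

(** The domain of the search problem in [aggregation_poly_time]. *)
Definition agg_input_dom (x : agg_input nets) :=
  [/\ K (agg_inst x), 0 < agg_scale x &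
      aggregation_instance
        (plus_net (real_graph R (inst_graph (agg_inst x)))
                  (real_net R (nets (agg_inst x) (agg_scale x))))
        (ratr (agg_diam x)) (partition_of (@agg_label _ x))].

Hypothesis solveP : forall x, agg_input_dom x -> exists f,
  aggregation_solution
    (plus_net (real_graph R (inst_graph (agg_inst x)))
              (real_net R (nets (agg_inst x) (agg_scale x))))
    (ratr (inst_beta (agg_inst x))) (ratr (agg_diam x))
    (partition_of (@agg_label _ x))
    (portals (real_net R (nets (agg_inst x) (agg_scale x)))) f /\
  forall v, solve x v = enum_rank (f (pblock (partition_of (@agg_label _ x)) v)).

Section Instance.
Variables (I : instance) (k : nat).
Hypothesis KI : K I.
Hypothesis k_reached : total_weight (inst_graph I) + 1 <= inst_gamma I ^+ k.
Hypothesis k_minimal : forall i, (i < k)%N ->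
  inst_gamma I ^+ i < total_weight (inst_graph I) + 1.
Let adm := K_adm KI.

Lemma real_reached : total_weight (real_graph R (inst_graph I)) + 1 <= real_gamma I ^+ k.
Proof. by rewrite -ratr_gamma -ratr_total_weight -(rmorph1 (@ratr R)) -rmorphD ler_rat. Qed.

Lemma real_minimal i : (i < k)%N ->
  real_gamma I ^+ i < total_weight (real_graph R (inst_graph I)) + 1.
Proof.
move=> ik; rewrite -ratr_gamma -ratr_total_weight -(rmorph1 (@ratr R)) -rmorphD.
by rewrite ltr_rat k_minimal.
Qed.

Lemma real_beta_ge1 : (1 < #|inst_vertex I|)%N -> 1 <= ratr (inst_beta I) :> R.
Proof. by move=> /(inst_beta_ge1 KI); rewrite -(rmorph1 (@ratr R)) ler_rat. Qed.

Lemma inst_card_gt1 : (0 < k)%N -> (1 < #|inst_vertex I|)%N.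
Proof. exact: (k_gt0 adm real_minimal). Qed.

Lemma net_scale_gt0 j : (j < k)%N -> inst_alpha I != 0 -> 0 < net_scale I j.
Proof.
move=> jk al0; have T1 := inst_card_gt1 (leq_ltn_trans (leq0n j) jk).
have b1 := inst_beta_ge1 KI T1; have g2 := inst_gamma_ge2 KI T1.
have a0 : 0 < inst_alpha I by rewrite lt_def al0 inst_alpha_ge0.
by rewrite /net_scale /inst_kappa !mulr_gt0 ?exprn_gt0 //; lra.
Qed.

Lemma level_input_dom j l : (j < k)%N -> inst_alpha I != 0 ->
  (forall v, l v < 2 * #|inst_vertex I|)%N ->
  (forall C, C \in partition_of l ->
     strong_diam_le (real_graph R (inst_graph I)) (real_gamma I ^+ j) C) ->
  agg_input_dom (level_input j l).
Proof.
move=> jk al0 lt diam; split; [exact: KI | exact: net_scale_gt0 |].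
apply: extend_instance => //=; rewrite ratr_gamma //.
exact: (gamma_exp_gt0 adm real_minimal real_beta_ge1).
Qed.

Lemma solved_step i : (i < k)%N ->
  (forall v, @solved_label I i v < 2 * #|inst_vertex I|)%N ->
  (forall C, C \in partition_of (@solved_label I i) ->
     strong_diam_le (real_graph R (inst_graph I)) (real_gamma I ^+ i) C) ->
  agg_step (real_graph R (inst_graph I)) (ratr (inst_alpha I)) (ratr (inst_beta I))
    (ratr (inst_tau I)) (real_gamma I ^+ i) (@solved_label I i) (@solved_label I i.+1).
Proof.
move=> ik lt diam; rewrite /agg_step fmorph_eq0 /=; case: eqP => // /eqP al0.
have [f [sol solE]] := solveP (level_input_dom ik al0 lt diam).
exists (real_net R (nets I (net_scale I i))), f; split.
- by rewrite -ratr_scale; apply: K_good => //; apply: net_scale_gt0.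
- by move: sol; rewrite /= ratr_gamma.
- by move=> v; apply: solE.
Qed.

Lemma inst_tau_ge1 : 1 <= ratr (inst_tau I) :> R.
Proof.
apply: (tau_ge1 adm (K_good KI (ltr01 : (0 : rat) < 1))).
by rewrite rmorph1.
Qed.

Lemma inst_tau_card : ratr (inst_alpha I) = 0 :> R ->
  #|inst_vertex I|%:R <= ratr (inst_tau I) :> R.
Proof.
have D0 : 0 < 1 / 2 :> rat by lra.
move=> al0; apply: (card_le_tau adm (K_good KI D0)) => //.
by rewrite -(rmorph1 (@ratr R)) ltr_rat; lra.
Qed.

Lemma solved_hierarchy :
  hierarchy (real_graph R (inst_graph I)) (real_gamma I) (8 * ratr (inst_alpha I) + 4)
    (ratr (inst_tau I)) k (fun i => partition_of (truncated_label (@solved_label I) k i)).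
Proof.
exact: (hierarchy_of_labels adm real_minimal real_beta_ge1 (lab := @solved_label I)
  (@fresh_inj _ _) (@fresh_lt _)
  inst_tau_ge1 inst_tau_card solved_step real_reached).
Qed.

Lemma solved_sparse i : (i <= k)%N ->
  (forall v, @solved_label I i v < 2 * #|inst_vertex I|)%N /\
  sparse_partition (real_graph R (inst_graph I)) (real_gamma I ^+ i)
    (8 * ratr (inst_alpha I) + 4) (ratr (inst_tau I)) (partition_of (@solved_label I i)).
Proof.
by case/(labels_sparse adm real_minimal real_beta_ge1 (lab := @solved_label I)
  (@fresh_inj _ _) (@fresh_lt _)
  inst_tau_ge1 inst_tau_card solved_step).
Qed.

(** Level [k - 1] has not reached the threshold, so [2 ^ (k - 1)] is at most [gamma ^ (k - 1)],
    hence less than the total weight plus 1, which is at most exponential in its bit-size. *)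
Lemma levels_le : (k <= (bits (total_weight (inst_graph I) + 1)).+2)%N.
Proof.
case: (posnP k) => [->//|k0]; have T1 := inst_card_gt1 k0.
have lt : (k.-1 < k)%N by rewrite prednK.
have := le_lt_trans _ (lt_le_trans (k_minimal lt) (rat_le_bits _)).
move=> /(_ (2 ^+ k.-1)); rewrite lerXn2r ?nnegrE //; last first.
- exact: inst_gamma_ge2.
- by have := inst_gamma_ge2 KI T1; lra.
by move=> /(_ isT); rewrite ltr_eXn2l // => h; rewrite -(prednK k0) !ltnS ltnW.
Qed.

End Instance.
End Algorithm.

Lemma hierarchy_computable (R : realType) (K : instance -> Prop) (nets : net_family) :
  (forall I : instance, K I ->
     admissible (real_graph R (inst_graph I)) (ratr (inst_alpha I))
       (ratr (inst_beta I)) (ratr (inst_tau I))) ->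
  (forall (I : instance) (D : rat), K I -> 0 < D ->
     good_net (real_graph R (inst_graph I)) (ratr (inst_alpha I))
       (ratr (inst_beta I)) (ratr (inst_tau I)) (ratr D) (real_net R (nets I D))) ->
  nets_poly_time K nets -> aggregation_poly_time R K nets ->
  hierarchy_poly_time K (@real_gamma R)
    (fun I => 8 * ratr (inst_alpha I) + 4) (fun I => ratr (inst_tau I)).
Proof.
move=> K_adm K_good netsP [p [c pP]].
have [k kP] := levels_exist K_adm K_good.
pose code (x : agg_input nets) := Cell (enc_instance (agg_inst x))
  (Cell (Num (agg_scale x))
    (Cell (enc_net (nets (agg_inst x) (agg_scale x)))
      (Cell (enc_labels (@agg_label _ x)) (Num (agg_diam x))))).
pose solved (x : agg_input nets)
    (L : inst_vertex (agg_inst x) + net_vertex (nets (agg_inst x) (agg_scale x)) -> nat) :=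
  (exists2 t, runs p (code x) (enc_labels L) t & (t <= c * dsize (code x) ^ c)%N) /\
  exists f, aggregation_solution
    (plus_net (real_graph R (inst_graph (agg_inst x)))
              (real_net R (nets (agg_inst x) (agg_scale x))))
    (ratr (inst_beta (agg_inst x))) (ratr (agg_diam x))
    (partition_of (@agg_label _ x))
    (portals (real_net R (nets (agg_inst x) (agg_scale x)))) f /\
  forall v, L v = enum_rank (f (pblock (partition_of (@agg_label _ x)) v)).
have ex x : exists L, agg_input_dom R K x -> solved x L.
  have [dx|] := pselect (agg_input_dom R K x); last by exists (fun=> 0%N).
  have [y [t [r le [f sol e]]]] := pP x dx.
  exists (fun v => enum_rank (f (pblock (partition_of (@agg_label _ x)) v)) : nat) => _; split.
    by exists t => //; rewrite e in r.
  by exists f.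
(* An instance may have many solutions; this fixes one that [p] outputs, so that the labels analysed
   mathematically are those that the loop computes. *)
pose solve x := projT1 (cid (ex x)).
have solveP x : agg_input_dom R K x -> solved x (solve x) by move/(projT2 (cid (ex x))).
pose lab := solved_label solve.
(* The program [p] is only guaranteed on valid instances; the inputs produced by the loop are valid
   by the diameter bounds of the previous level. *)
have dom I j : K I -> (j < k I)%N -> inst_alpha I != 0 ->
    agg_input_dom R K (level_input nets j (lab I j)).
  move=> KI jk al0; have [kr km] := kP I KI.
  have [lt [_ diam _]] := solved_sparse K_adm K_good
    (fun x dx => (solveP x dx).2) KI km (ltnW jk).
  exact: (level_input_dom K_adm K_good KI km).
have [q [d qP]] : @poly_time_solvable instance K enc_instance (fun I y =>
    y = enc_seq [seq enc_labels (truncated_label (lab I) (k I) i) | i <- iota 0 (k I).+1]).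
  apply: (@computable_labels _ nets _ _ (fun I j => solve (level_input nets j (lab I j)))) => //.
  - move=> I j KI jk; have [kr km] := kP I KI.
    move: jk; rewrite leq_eqVlt => /orP[/eqP ->|jk]; first by rewrite leqnn.
    by rewrite leqNgt jk leNgt km.
  - by move=> I KI; have [kr km] := kP I KI; apply: (levels_le K_adm K_good).
  - by move=> I j KI jk; have [kr km] := kP I KI; apply: (net_scale_gt0 K_adm K_good KI km).
  - move=> I j v KI jk; have [kr km] := kP I KI.
    by have [lt _] := solved_sparse K_adm K_good
      (fun x dx => (solveP x dx).2) KI km jk; apply: lt.
  - by move=> I j al0; rewrite /lab /= al0.
  - by move=> I j /negPf al0; rewrite /lab /= al0.
  - exists p, c => I j [KI jk al0]; exact: (solveP _ (dom I j KI jk al0)).1.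
exists q, d => I KI; have [y [t [r le e]]] := qP I KI; exists y, t; split=> //.
have [kr km] := kP I KI; exists (k I), (truncated_label (lab I) (k I)); split=> //.
exact: (solved_hierarchy K_adm K_good (fun x dx => (solveP x dx).2)).
Qed.

Theorem theorem1p7 (R : realType) :
  (forall (T : finType) (G : wgraph R T) (alpha beta tau : R),
     admissible G alpha beta tau ->
     (forall D : R, 0 < D ->
        exists N : dangling_net R T, good_net G alpha beta tau D N) ->
     exists (k : nat) (CC : nat -> {set {set T}}),
       hierarchy G (2 * beta * (2 * alpha + 1)) (8 * alpha + 4) tau k CC) /\
  (forall (K : instance -> Prop) (nets : net_family),
     (forall I : instance, K I ->
        admissible (real_graph R (inst_graph I)) (ratr (inst_alpha I))
          (ratr (inst_beta I)) (ratr (inst_tau I))) ->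
     (forall (I : instance) (D : rat), K I -> 0 < D ->
        good_net (real_graph R (inst_graph I)) (ratr (inst_alpha I))
          (ratr (inst_beta I)) (ratr (inst_tau I)) (ratr D)
          (real_net R (nets I D))) ->
     nets_poly_time K nets ->
     aggregation_poly_time R K nets ->
     hierarchy_poly_time K
       (fun I => 2 * ratr (inst_beta I) * (2 * ratr (inst_alpha I) + 1) : R)
       (fun I => 8 * ratr (inst_alpha I) + 4 : R)
       (fun I => ratr (inst_tau I) : R)).
Proof.
split; first exact: hierarchy_exists.
exact: hierarchy_computable.
Qed.
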